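(* Let $\varphi=(\varphi_n)_{n\ge0}$ be the competition interface defined in the context. Then, identifying $\mathbb{R}^2$ with $\mathbb{C}$ (so that $e^{i\alpha}=(\cos\alpha,\sin\alpha)$), $$\lim_{n\to\infty}\frac{\varphi_n}{|\varphi_n|}=e^{i\theta}\qquad \mathbb{P}\text{-a.s.},$$ where $\theta=\theta(\mathcal W)$ is a random angle in $[0,90^\circ]$ whose law is given by $$\mathbb{P}(\theta\le\alpha)=\frac{\sqrt{\sin\alpha}}{\sqrt{\sin\alpha}+\sqrt{\cos\alpha}},\qquad \alpha\in[0,90^\circ].$$
   Context: Let $\mathcal W=(w(z),z\in\mathbb{Z}^2)$ be i.i.d. exponential random variables of mean 1, with law $\mathbb{P}$. For $z=(i,j)$, $z'=(i',j')$ with $i\le i'$, $j\le j'$, an up/right path from $z$ to $z'$ is a sequence $z_1=z,\dots,z_n=z'$ with $z_{k+1}-z_k\in\{(1,0),(0,1)\}$; let $G(z,z')=\max_\pi\sum_{z''\in\pi}w(z'')$, the maximum over up/right paths $\pi$ from $z$ to $z'$ (endpoints included). Write $\mathbb{Z}^+=\{1,2,\dots\}$, and for $z\in(\mathbb{Z}^+)^2$ let $G(z)=G((1,1),z)$; set $G(i,j)=0$ if $i=0$ or $j=0$. The competition interface is defined by $\varphi_0=(1,1)$ and, for $n\ge0$, $\varphi_{n+1}=\arg\min\{G(\varphi_n+(1,0)),G(\varphi_n+(0,1))\}$ (i.e. $\varphi_{n+1}$ is whichever of $\varphi_n+(1,0)$, $\varphi_n+(0,1)$ has smaller value of $G$;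 ties have probability zero). $|\cdot|$ is the Euclidean norm. *)

(* Defs.v *)
From HB Require Import structures.
From mathcomp Require Import all_boot all_order all_algebra.
From mathcomp Require Import all_classical all_reals all_analysis.
Set Implicit Arguments. Unset Strict Implicit. Unset Printing Implicit Defensive.
Import Order.TTheory GRing.Theory Num.Theory.
Local Open Scope classical_set_scope.
Local Open Scope ring_scope.

Definition up_right_step (a b : int * int) : bool :=
  (b == (a.1 + 1, a.2)%R) || (b == (a.1, a.2 + 1)%R).

Definition up_right_path (z z' : int * int) (p : seq (int * int)) : Prop :=
  path up_right_step z p /\ last z p = z'.

(* G(z, z') = max over up/right paths from z to z' of the sum of the weights
   along the path (endpoints included); written as a sup over the (finite,
   nonempty when z <= z') set of path weights. *)
Definition Gpp {T : Type} {R : realType} (w : int * int -> T -> R)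
  (z z' : int * int) (om : T) : R :=
  sup [set s | exists p, up_right_path z z' p /\ s = \sum_(x <- z :: p) w x om].

Definition G {T : Type} {R : realType} (w : int * int -> T -> R)
  (z : int * int) (om : T) : R :=
  if (z.1 <= 0) || (z.2 <= 0) then 0 else Gpp w (1, 1)%R z om.

(* Competition interface: phi_0 = (1,1), phi_{n+1} = the one of
   phi_n + (1,0), phi_n + (0,1) with smaller G (ties, which have probability
   zero, are broken towards phi_n + (0,1)). *)
Fixpoint phi {T : Type} {R : realType} (w : int * int -> T -> R) (om : T)
  (n : nat) : int * int :=
  match n with
  | 0 => (1, 1)%R
  | n'.+1 =>
      let a := phi w om n' in
      let r := (a.1 + 1, a.2)%R in
      let u := (a.1, a.2 + 1)%R in
      if G w r om < G w u om then r else u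
  end.

Definition enorm {R : realType} (z : int * int) : R :=
  Num.sqrt ((z.1)%:~R ^+ 2 + (z.2)%:~R ^+ 2).

Definition mutually_independent {d} {I : eqType} {T : measurableType d}
  {R : realType} (P : probability T R) (X : I -> T -> R) : Prop :=
  forall (s : seq I) (B : I -> set R), uniq s ->
    (forall i, measurable (B i)) ->
    P (\bigcap_(i in [set` s]) (X i @^-1` B i)) =
    (\prod_(i <- s) P (X i @^-1` B i))%E.

(* Main.v *)
Require Import Defs.
From HB Require Import structures.
From mathcomp Require Import all_boot all_order all_algebra.
From mathcomp Require Import all_classical all_reals all_analysis.
From mathcomp Require Import measurable_realfun ring lra zify.
Import Order.TTheory GRing.Theory Num.Theory numFieldNormedType.Exports.
Local Open Scope classical_set_scope.
Local Open Scope ring_scope.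

(** The interface [phi] separates the points whose geodesic from [(1, 1)] goes
    through [(2, 1)] from those whose geodesic goes through [(1, 2)], so it
    passes to the right of [z] as soon as [G((2, 1), z) < G((1, 2), z)].
    To decide this for all [z = N (p, q)] at once, put on the north and east
    sides of a large box the boundary weights of the stationary process of
    parameter [r], with rates [r] and [1 - r].  Burke's property makes the
    increments of the resulting value function along any horizontal or vertical
    line independent exponentials of these rates, and its first step from [(1, 1)]
    goes up with probability [1 - r].  In that case [phi] passes to the right of
    [z] unless the optimal path leaves the box of [z] through its north side;
    comparing with the stationary process of a parameter [lam < r] (larger north
    weights, same bulk) shows that this is exponentially unlikely in [N] when
    [p / r ^+ 2 < q / (1 - r) ^+ 2].  Hence [limsup (slope of phi) <= s] has
    probability at least [1 - r] whenever [((1 - r) / r) ^+ 2 < s], and by symmetry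
    [s <= liminf (slope of phi)] has probability at least [1 - r] whenever
    [s < (r / (1 - r)) ^+ 2].  These bounds leave no room: the two events are
    disjoint for different [s], so the slope converges and its law is determined. *)

(** * Exponential laws *)

(** The condition on [r] says that [p / r + q / (1 - r)], the mean of the stationary passage time
    over the vector [(p, q)], has a positive derivative at [r]. Some smaller [lam] then has a
    smaller mean although its north weights are larger, and a deviation bound for each of the two
    parameters makes a win of [lam] exponentially unlikely. The obstacle is that the stationary
    weights sit at the far corner of a finite box, so one box serves only finitely many [N]. The
    event that the value function starts upwards changes with the box, but its probability does not.
    The estimate is therefore proved on windows [N1 <= N < N1 + K] with [N1] independent of [K], for
    events that no longer mention the box, and [K] tends to infinity by continuity from above.
    Nothing is lost in the end because, with [c = sqrt s], the two lower bounds tend to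
    [c / (1 + c)] and [1 / (1 + c)], whose sum is 1. *)

Section expo.
Context {R : realType}.

Definition idTR : measurableTypeR R -> R := idfun.

Lemma measurable_idTR : measurable_fun setT idTR.
Proof. by move=> _ A mA; rewrite setTI. Qed.

HB.instance Definition _ := isMeasurableFun.Build _ _ _ _ idTR measurable_idTR.

Definition exponential_measure (l : R) (l0 : 0 < l) :
  probability (measurableTypeR R) R.
Proof. refine (exponential_prob l : probability _ R); exact: l0. Defined.

(* [exponential_prob] lives on [measurableTypeR R], whose display is not the one
   of the canonical measurable structure of [R]. *)
Definition expo (l : R) (l0 : 0 < l) : probability R R :=
  distribution (exponential_measure l l0) (idTR : {mfun _ >-> _}).

Lemma expoE (l : R) (l0 : 0 < l) A : expo l l0 A = exponential_prob l A.
Proof. by []. Qed.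

Lemma expo_lt0 (l : R) (l0 : 0 < l) : expo l l0 `]-oo, 0[%classic = 0%E.
Proof.
rewrite expoE /exponential_prob; apply: integral0_eq => x /=.
by rewrite in_itv /= => x0; rewrite lt0_exponential_pdf.
Qed.

Lemma expo_tail (l : R) (l0 : 0 < l) (t : R) : 0 <= t ->
  expo l l0 `]t, +oo[%classic = (expR (- l * t))%:E.
Proof.
move=> t0.
have H0 : expo l l0 `]-oo, t]%classic = (1 - (expR (- l * t))%:E)%E.
  move: t0; rewrite le_eqVlt => /predU1P[<-|t0].
    rewrite mulr0 expR0 subee//.
    have -> : `]-oo, 0]%classic = `]-oo, 0[%classic `|` [set (0:R)] :> set R.
      by rewrite setUitv1.
    rewrite measureU//; last first.
      apply/seteqP; split => x //= [].
      by rewrite in_itv /= => + x0; rewrite x0 ltxx.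
    rewrite [X in (X + _)%E](expo_lt0 l l0) add0e. exact: integral_set1.
  have -> : `]-oo, t]%classic = `]-oo, 0[%classic `|` `[0, t]%classic :> set R.
    apply/seteqP; split=> x /=; rewrite !in_itv /=.
      by move=> xt; case: (ltP x 0) => x0; [left|right; rewrite xt].
    by case=> [x0|/andP[//]]; rewrite (le_trans (ltW x0) (ltW t0)).
  rewrite measureU//.
    rewrite -[RHS]add0e; congr (_ + _)%E; first exact: expo_lt0.
    exact: exponential_prob_itv0c.
  apply/seteqP; split => x //= [].
  by rewrite !in_itv /= => x0 /andP[]; rewrite leNgt x0.
by rewrite -setCitvl probability_setC// H0 oppeB// addeA subee// add0e.
Qed.

Lemma expo_tail_lt0 (l : R) (l0 : 0 < l) (t : R) : t < 0 ->
  expo l l0 `]t, +oo[%classic = 1%E.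
Proof.
move=> t0; apply/eqP; rewrite eq_le probability_le1//=.
rewrite -[X in (X <= _)%E](_ : expo l l0 `]0, +oo[%classic = 1%E).
  by apply: le_measure; rewrite ?inE// => x /=; rewrite !in_itv /= !andbT; lra.
by rewrite expo_tail// mulr0 expR0.
Qed.

(* Open right half-lines form a pi-system generating the Borel sets. *)
Lemma measure_unique_tail (m1 m2 : {measure set R -> \bar R}) :
  (m1 setT < +oo)%E ->
  (forall t, m1 `]t, +oo[%classic = m2 `]t, +oo[%classic) ->
  forall A, measurable A -> m1 A = m2 A.
Proof.
move=> m1oo H A mA.
refine (@measure_unique _ R R (@RGenOInfty.G R) (fun n => `](- n%:R), +oo[%classic) _ _ _ _ m1 m2 _ _ A mA) => //.
- exact: RGenOInfty.measurableE.
- move=> _ _ [x ->] [y ->]; exists (Num.max x y).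
  apply/seteqP; split => z /=; rewrite !in_itv /= !andbT gt_max.
    by case=> -> ->.
  by move=> /andP.
- by move=> i; exists (- i%:R).
- apply/seteqP; split => // x _.
  exists (Num.truncn `|x|).+1 => //=.
  rewrite in_itv /= andbT ltrNl (le_lt_trans (ler_norm _))// normrN.
  by rewrite truncnS_gt.
- by move=> _ [x ->].
- move=> k; apply: le_lt_trans m1oo.
  by apply: le_measure; rewrite ?inE.
Qed.

Lemma measure_unique_rect {d1 d2} {T1 : measurableType d1} {T2 : measurableType d2}
  (m1 m2 : {measure set (T1 * T2) -> \bar R}) :
  (m1 setT < +oo)%E ->
  (forall A B, measurable A -> measurable B -> m1 (A `*` B) = m2 (A `*` B)) ->
  forall X, measurable X -> m1 X = m2 X.
Proof.
move=> m1oo H X mX.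
apply: (measure_unique [set C | exists A, measurable A /\ exists B, measurable B /\ C = A `*` B]
   (fun _ => setT)) => //.
- rewrite measurable_prod_measurableType; congr (<<s _ >>).
  apply/seteqP; split => C /=.
    by move=> [A mA [B mB <-]]; exists A; split => //; exists B.
  by move=> [A [mA [B [mB ->]]]]; exists A => //; exists B.
- move=> _ _ [A [mA [B [mB ->]]]] [A' [mA' [B' [mB' ->]]]].
  exists (A `&` A'); split; first exact: measurableI.
  exists (B `&` B'); split; first exact: measurableI.
  by rewrite setXI.
- by move=> _; exists setT; split => //; exists setT; split => //; rewrite setXTT.
- by apply/seteqP; split => // x _; exists 0%N.
- by move=> _ [A [mA [B [mB ->]]]]; exact: H.
Qed.

End expo.

Section expo_facts.
Context {R : realType}.
Local Notation mu := (@lebesgue_measure R).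

Lemma exponential_measure_dominates (l : R) (l0 : 0 < l) :
  exponential_measure l l0 `<< mu.
Proof.
apply/null_content_dominatesP => A mA muA0.
apply: null_set_integral => //=; apply: measurable_funTS => /=.
apply/measurable_EFinP; exact: measurable_exponential_pdf.
Qed.

Lemma integral_expo (l : R) (l0 : 0 < l) (f : R -> \bar R) :
  measurable_fun setT f -> (forall x, 0 <= f x)%E ->
  (\int[expo l l0]_x f x = \int[mu]_x (f x * (exponential_pdf l x)%:E))%E.
Proof.
move=> mf f0.
transitivity (\int[exponential_measure l l0]_x f x)%E.
  by rewrite (ge0_integral_pushforward measurable_idTR).
(* Integrals against the measure go through its Radon-Nikodym derivative, which equals the density
   almost everywhere because both have the same integral over every measurable set. *)
have numu := exponential_measure_dominates l l0.
rewrite -(Radon_Nikodym_SigmaFinite.change_of_variables numu)//.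
have mpdf : measurable_fun setT (EFin \o exponential_pdf l).
  by apply/measurable_EFinP; exact: measurable_exponential_pdf.
apply: ae_eq_integral => //.
- apply: emeasurable_funM => //; apply: (measurable_int mu).
  exact: Radon_Nikodym_SigmaFinite.f_integrable.
- exact: emeasurable_funM.
- apply: ae_eqe_mul2l => /=; apply: integral_ae_eq => //=.
  + exact: Radon_Nikodym_SigmaFinite.f_integrable.
  + by move=> E _ mE; rewrite -Radon_Nikodym_SigmaFinite.f_integral.
Qed.

Lemma expo_mgf (l : R) (l0 : 0 < l) (c : R) : c < l ->
  (\int[expo l l0]_x (expR (c * x))%:E = (l / (l - c))%:E)%E.
Proof.
move=> cl; have lc0 : 0 < l - c by rewrite subr_gt0.
rewrite integral_expo; last 2 first.
- apply/measurable_EFinP; apply: measurableT_comp => //; exact: measurable_funM.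
- by move=> x; rewrite lee_fin expR_ge0.
transitivity (\int[mu]_x ((l / (l - c))%:E * (exponential_pdf (l - c) x)%:E))%E.
  apply: eq_integral => x _; rewrite -!EFinM; congr EFin.
  case: (ltP x 0) => x0; first by rewrite !lt0_exponential_pdf// !mulr0.
  rewrite !exponential_pdfE// mulrCA mulrA -mulrA -expRD -mulrA (mulrA (_^-1)).
  rewrite mulVf ?gt_eqF// mul1r; congr (_ * expR _); lra.
rewrite ge0_integralZl//=.
- by rewrite integral_exponential_pdf// mule1.
- by apply/measurable_EFinP; exact: measurable_exponential_pdf.
- by move=> x _; rewrite lee_fin exponential_pdf_ge0// ltW.
- by rewrite lee_fin divr_ge0// ltW.
Qed.

End expo_facts.

Section measure_tools.
Context {R : realType}.

Definition pushforward_measure {d1 d2} {T1 : measurableType d1} {T2 : measurableType d2}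
  (m : {measure set T1 -> \bar R}) (f : T1 -> T2) (mf : measurable_fun setT f) :
  {measure set T2 -> \bar R}.
Proof. refine (pushforward m f : {measure set T2 -> \bar R}); exact: mf. Defined.

(** Makes a measure of the right side of an independence claim, a law times a fixed probability, so
    that uniqueness of measures applies. *)
Lemma measure_scale_nneg {d} {T : measurableType d} (m : {measure set T -> \bar R})
  (k : \bar R) : (0 <= k)%E -> k \is a fin_num ->
  exists m' : {measure set T -> \bar R}, forall A, m' A = (k * m A)%E.
Proof.
case: k => // r; rewrite lee_fin => r0 _.
by exists (mscale (NngNum r0) m).
Qed.

(** Both sides are finite measures in [D] that agree on rectangles. The event [C] carries the other
    variables of a family, so that a pair can be replaced by functions of it without losing
    independence from the rest. *)
Lemma indep_extend {d d1 d2} {T : measurableType d} {T1 : measurableType d1}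
  {T2 : measurableType d2} (P : probability T R) (X : T -> T1) (Y : T -> T2)
  (mu : probability T1 R) (nu : probability T2 R) (C : set T) :
  measurable_fun setT X -> measurable_fun setT Y -> measurable C ->
  (forall A B, measurable A -> measurable B ->
    P ((X @^-1` A `&` Y @^-1` B) `&` C) = (mu A * nu B * P C)%E) ->
  forall D, measurable D ->
    P ((fun t => (X t, Y t)) @^-1` D `&` C) = ((mu \x nu)%E D * P C)%E.
Proof.
move=> mX mY mC H D mD.
have mXY : measurable_fun setT (fun t => (X t, Y t)) by exact: measurable_fun_pair.
have [m' m'E] := measure_scale_nneg (mu \x nu)%E (P C) (measure_ge0 _ _)
  (fin_num_measure _ _ mC).
rewrite muleC -m'E.
refine (measure_unique_rect (pushforward_measure (mrestr P mC) _ mXY) m' _ _ D mD).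
- rewrite /pushforward_measure /= /pushforward /mrestr /= (le_lt_trans (probability_le1 P _))//.
    by apply: measurableI => //; rewrite -[X in measurable X]setTI; exact: mXY.
  by rewrite ltry.
- move=> A B mA mB; rewrite m'E /= product_measure1E// muleC -H//.
Qed.

End measure_tools.

(** * Burke's property on a single cell *)

Section burke.
Context {R : realType}.

Lemma expo_memoryless (l : R) (l0 : 0 < l) (t : R) (A : set R) :
  0 <= t -> measurable A ->
  expo l l0 ((fun x => x - t) @^-1` A `&` `]t, +oo[%classic) =
  ((expR (- l * t))%:E * expo l l0 A)%E.
Proof.
move=> t0 mA.
have mt : measurable_fun setT (fun x : R => x - t) by exact: measurable_funB.
have mI : measurable (`]t, +oo[%classic : set R) by [].
have [m' m'E] := measure_scale_nneg (expo l l0) (expR (- l * t))%:E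
  (expR_ge0 _) isT.
rewrite -m'E.
refine (measure_unique_tail (pushforward_measure (mrestr (expo l l0) mI) _ mt) m' _ _ A mA).
- rewrite /pushforward_measure /= /pushforward /mrestr /= (le_lt_trans (probability_le1 _ _))//.
    by apply: measurableI => //; rewrite -[X in measurable X]setTI; exact: mt.
  by rewrite ltry.
- move=> s; rewrite m'E /pushforward_measure /= /pushforward /mrestr.
  case: (leP 0 s) => s0.
    rewrite expo_tail// -EFinM -expRD.
    transitivity (expo l l0 `]s + t, +oo[%classic).
      congr (expo l l0 _); apply/seteqP; split => x /=; rewrite !in_itv /= !andbT; last first.
        by move=> ?; split; lra.
      by case; lra.
    rewrite expo_tail ?addr_ge0//; congr (expR _)%:E; lra.
  rewrite expo_tail_lt0// mule1 -(expo_tail l l0 t t0).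
  congr (expo l l0 _); apply/seteqP; split => x /=; rewrite !in_itv /= !andbT.
    by case.
  by move=> ?; split; lra.
Qed.

Variables (rho sig : R) (rho0 : 0 < rho) (sig0 : 0 < sig) (rs : rho + sig = 1).
Local Notation kap := (expo rho rho0 \x expo sig sig0)%E.

Let mx (p : R * R) : R := Num.min p.1 p.2.
Let dv (p : R * R) : R * R := (Num.max (p.1 - p.2) 0, Num.max (p.2 - p.1) 0).

(** The rates add up to 1, so both coordinates exceed [t] with probability exp(- t); given this, the
    two excesses are a fresh copy of the pair. *)
Lemma product_expo_memoryless (t : R) (D : set (R * R)) : 0 <= t -> measurable D ->
  kap ((fun p => (p.1 - t, p.2 - t)) @^-1` D `&` (`]t, +oo[ `*` `]t, +oo[)) =
  ((expR (- t))%:E * kap D)%E.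
Proof.
move=> t0 mD.
have mt : measurable_fun setT (fun p : R * R => (p.1 - t, p.2 - t)).
  by apply: measurable_fun_pair; apply: measurable_funB.
have mI : measurable ((`]t, +oo[ `*` `]t, +oo[) : set (R * R)) by exact: measurableX.
have [m' m'E] := measure_scale_nneg kap (expR (- t))%:E (expR_ge0 _) isT.
rewrite -m'E.
refine (measure_unique_rect (pushforward_measure (mrestr kap mI) _ mt) m' _ _ D mD).
- rewrite /pushforward_measure /= /pushforward /mrestr /= (le_lt_trans (probability_le1 kap _))//.
    apply: measurableI => //; rewrite -[X in measurable X]setTI; exact: mt.
  by rewrite ltry.
- move=> A B mA mB; rewrite m'E /= product_measure1E// /pushforward_measure /= /pushforward /mrestr.
  have -> : (fun p : R * R => (p.1 - t, p.2 - t)) @^-1` (A `*` B)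
     `&` (`]t, +oo[ `*` `]t, +oo[) =
     ((fun x => x - t) @^-1` A `&` `]t, +oo[%classic) `*`
     ((fun x => x - t) @^-1` B `&` `]t, +oo[%classic).
    by apply/seteqP; split => -[x y] /= [[? ?] [? ?]].
  have mtt : measurable_fun setT (fun x : R => x - t) by exact: measurable_funB.
  have mti E : measurable E -> measurable ((fun x : R => x - t) @^-1` E `&` `]t, +oo[%classic).
    move=> mE; apply: measurableI => //; rewrite -[X in measurable X]setTI; exact: mtt.
  rewrite product_measure1E; [|exact: mti|exact: mti].
  transitivity (((expR (- rho * t))%:E * expo rho rho0 A) * ((expR (- sig * t))%:E * expo sig sig0 B))%E.
    by congr (_ * _)%E; exact: expo_memoryless.
  rewrite muleACA -EFinM -expRD.
  congr ((expR _)%:E * _)%E; rewrite -mulrDl -opprD rs; lra.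
Qed.

Lemma measurable_pair_min : measurable_fun setT mx.
Proof. exact: measurable_minr. Qed.

Lemma measurable_pair_diff : measurable_fun setT dv.
Proof.
by apply: measurable_fun_pair; apply: measurable_maxr => //; exact: measurable_funB.
Qed.

(** Subtracting [t] from both coordinates leaves [dv] unchanged, so by the memoryless property the
    event that the minimum exceeds [t] does not bias the differences. *)
Lemma min_diff_indep (E : set (R * R)) (F : set R) : measurable E -> measurable F ->
  kap (mx @^-1` F `&` dv @^-1` E) = (kap (dv @^-1` E) * expo 1 ltr01 F)%E.
Proof.
move=> mE mF.
have mdE : measurable (dv @^-1` E) by rewrite -[X in measurable X]setTI; exact: measurable_pair_diff.
have mmF G : measurable G -> measurable (mx @^-1` G).
  by move=> mG; rewrite -[X in measurable X]setTI; exact: measurable_pair_min.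
have [m' m'E] := measure_scale_nneg (expo 1 ltr01) (kap (dv @^-1` E)) (measure_ge0 _ _)
   (fin_num_measure (kap : probability _ R) _ mdE).
rewrite -m'E.
have key t : 0 <= t -> kap (mx @^-1` `]t, +oo[%classic `&` dv @^-1` E) =
   (kap (dv @^-1` E) * expo 1 ltr01 `]t, +oo[%classic)%E.
  move=> t0; rewrite (expo_tail 1 ltr01 t t0) mulN1r muleC -(product_expo_memoryless t _ t0 mdE); congr (kap _).
  apply/seteqP; split => -[x y]; rewrite /= !in_itv /= !andbT /mx lt_min /= /dv /=.
    by move=> [/andP[? ?] ?]; split => //; rewrite [X in (X, _)](_ : _ = Num.max (x - y) 0);
    [rewrite [X in (_, X)](_ : _ = Num.max (y - x) 0)//; congr Num.max; lra|congr Num.max; lra].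
  by move=> [? [-> ->]]; split => //; rewrite [X in (X, _)](_ : _ = Num.max (x - t - (y - t)) 0);
    [rewrite [X in (_, X)](_ : _ = Num.max (y - t - (x - t)) 0)//; congr Num.max; lra|congr Num.max; lra].
refine (measure_unique_tail (pushforward_measure (mrestr kap mdE) _ measurable_pair_min) m' _ _ F mF).
- rewrite /pushforward_measure /= /pushforward /mrestr /= (le_lt_trans (probability_le1 kap _))//.
    by apply: measurableI => //; exact: mmF.
  by rewrite ltry.
- move=> t; rewrite m'E /pushforward_measure /= /pushforward /mrestr.
  case: (leP 0 t) => t0; first exact: key.
  rewrite expo_tail_lt0// mule1; apply/eqP; rewrite eq_le; apply/andP; split.
    by apply: le_measure; rewrite ?inE//; apply: measurableI => //; exact: mmF.
  have := key 0 (lexx _); rewrite (expo_tail 1 ltr01 0 (lexx _)) mulr0 expR0 mule1 => <-.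
  apply: le_measure; rewrite ?inE//; try by apply: measurableI => //; exact: mmF.
  apply: setSI => p /=; rewrite !in_itv /= !andbT; exact: lt_trans.
Qed.

(* [min_diff_indep] says that (differences, minimum) has a product law; replacing
   the minimum by the independent weight [q.2], which has the same law, preserves
   the law of the pair. *)
Lemma burke_local (A B : set R) : measurable A -> measurable B ->
  (kap \x expo 1 ltr01)%E
    [set q | A (q.2 + Num.max (q.1.1 - q.1.2) 0) /\
             B (q.2 + Num.max (q.1.2 - q.1.1) 0)] =
  (expo rho rho0 A * expo sig sig0 B)%E.
Proof.
move=> mA mB.
pose g (z : (R * R) * R) : R * R := (z.2 + z.1.1, z.2 + z.1.2).
have mg : measurable_fun setT g.
  by apply: measurable_fun_pair; apply: measurable_funD => //;
    apply: measurableT_comp.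
pose h (q : (R * R) * R) := (dv q.1, q.2).
have mh : measurable_fun setT h.
  by apply: measurable_fun_pair => //; apply: measurableT_comp => //; exact: measurable_pair_diff.
pose k (p : R * R) := (dv p, mx p).
have mk : measurable_fun setT k.
  by apply: measurable_fun_pair; [exact: measurable_pair_diff|exact: measurable_pair_min].
have mN : measurable (g @^-1` (A `*` B)).
  by rewrite -[X in measurable X]setTI; apply: mg => //; exact: measurableX.
transitivity (pushforward_measure (kap \x expo 1 ltr01)%E h mh (g @^-1` (A `*` B))).
  by rewrite /pushforward_measure /= /pushforward.
transitivity (pushforward_measure kap k mk (g @^-1` (A `*` B))).
  refine (measure_unique_rect (pushforward_measure (kap \x expo 1 ltr01)%E h mh)
    (pushforward_measure kap k mk) _ _ _ mN).
    rewrite /pushforward_measure /= /pushforward /= (le_lt_trans (probability_le1 (kap \x expo 1 ltr01)%E _))//.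
      by rewrite -[X in measurable X]setTI; exact: mh.
    by rewrite ltry.
  move=> E F mE mF; rewrite /pushforward_measure /= /pushforward.
  have -> : h @^-1` (E `*` F) = (dv @^-1` E) `*` F by [].
  rewrite product_measure1E//; last by rewrite -[X in measurable X]setTI; exact: measurable_pair_diff.
  by rewrite -(min_diff_indep _ _ mE mF) setIC.
have kgAB : k @^-1` (g @^-1` (A `*` B)) = A `*` B.
  (* [g] inverts [k]: min(x, y) + max(x - y, 0) = x, and symmetrically for y. *)
  have kg x y : g (k (x, y)) = (x, y).
    rewrite /g /k /mx /dv /=; congr (_, _); case: (leP x y) => xy.
    + by rewrite max_r ?addr0// subr_le0.
    + by rewrite max_l; [lra|rewrite subr_ge0 ltW].
    + by rewrite max_l; [lra|rewrite subr_ge0].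
    + by rewrite max_r ?addr0// subr_le0 ltW.
  apply/seteqP; split => -[x y] H; first by rewrite -(kg x y).
  by have := H; rewrite -{1}(kg x y).
transitivity (kap (A `*` B)); last exact: product_measure1E.
by rewrite -[in RHS]kgAB.
Qed.

End burke.

(** * Finite families of independent variables *)

Section independent_families.
Context {R : realType} {d : measure_display} {T : measurableType d}.
Context (P : probability T R) {I : eqType} (X : I -> T -> R).
Context (mX : forall i, measurable_fun setT (X i)).
Context (law : I -> probability R R).

Definition rect (s : seq I) (B : I -> set R) : set T :=
  \bigcap_(i in [set` s]) X i @^-1` B i.

(** Independence and marginals are asked of finite lists only: the increments of the stationary
    field are independent along suitable lines, not as a whole family. *)
Definition indep_on (s : seq I) : Prop := uniq s /\
  forall B, (forall i, measurable (B i)) ->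
    P (rect s B) = (\prod_(i <- s) law i (B i))%E.

Lemma rect_cons i s B : rect (i :: s) B = X i @^-1` B i `&` rect s B.
Proof.
apply/seteqP; split => t.
  move=> H; split; first by apply: (H i); rewrite /= inE eqxx.
  by move=> j js; apply: (H j); rewrite /= inE; apply/orP; right.
by move=> [H1 H2] j /=; rewrite inE => /predU1P[->//|js]; exact: (H2 j).
Qed.

Lemma measurable_preim (f : T -> R) (B : set R) :
  measurable_fun setT f -> measurable B -> measurable (f @^-1` B).
Proof. by move=> mf mB; rewrite -[X in measurable X]setTI; exact: mf. Qed.

Lemma measurable_rect s B : (forall i, measurable (B i)) -> measurable (rect s B).
Proof.
move=> mB; elim: s => [|i s IH]; first by rewrite /rect set_nil bigcap_set0.
by rewrite rect_cons; apply: measurableI => //; exact: measurable_preim.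
Qed.

Lemma eq_rect s B B' : {in s, forall i, B i = B' i} -> rect s B = rect s B'.
Proof.
by move=> H; apply/seteqP; split => t Ht i /= si; have := Ht i si; rewrite /= H.
Qed.

Lemma indep_on_perm s s' : perm_eq s s' -> indep_on s -> indep_on s'.
Proof.
move=> pss' [us H]; split; first by rewrite -(perm_uniq pss').
move=> B mB; rewrite -(perm_big _ pss')/= -H//; congr (P _).
by apply/seteqP; split => t Ht i /= si; apply: Ht; rewrite /= ?(perm_mem pss')// -(perm_mem pss').
Qed.

Let upd (B : I -> set R) i A := fun j => if j == i then A else B j.

Let mupd B i A : (forall i, measurable (B i)) -> measurable A ->
  forall j, measurable (upd B i A j).
Proof. by move=> mB mA j; rewrite /upd; case: eqP. Qed.

Let rect_upd B i A s : i \notin s -> rect s (upd B i A) = rect s B.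
Proof.
move=> si; apply: eq_rect => j js; rewrite /upd; case: eqP => // ji.
by move: si; rewrite -ji js.
Qed.

Lemma indep_on_consE i s B A : indep_on (i :: s) -> (forall i, measurable (B i)) ->
  measurable A -> P (X i @^-1` A `&` rect s B) = (law i A * \prod_(j <- s) law j (B j))%E.
Proof.
move=> [/= /andP[si us] H] mB mA.
have := H (upd B i A) (mupd B i A mB mA).
rewrite rect_cons rect_upd// big_cons {1 2}/upd eqxx => ->; congr (_ * _)%E.
apply: eq_big_seq => j js; rewrite /upd; case: eqP => // ji.
by move: si; rewrite -ji js.
Qed.

Lemma indep_on_behead i s : indep_on (i :: s) -> indep_on s.
Proof.
move=> H; split; first by case: H => /= /andP[].
move=> B mB; have := indep_on_consE i s B setT H mB measurableT.
by rewrite preimage_setT setTI probability_setT mul1e.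
Qed.

Lemma indep_on_catr s s' : indep_on (s ++ s') -> indep_on s'.
Proof. by elim: s => //= i s IH /indep_on_behead. Qed.

Lemma indep_on_catl s s' : indep_on (s ++ s') -> indep_on s.
Proof. by move=> H; apply: (indep_on_catr s'); apply: indep_on_perm H; rewrite perm_catC. Qed.

Lemma indep_on_sub s s' : uniq s' -> {subset s' <= s} -> indep_on s -> indep_on s'.
Proof.
move=> us' ss' H; apply: (indep_on_catl s' [seq x <- s | x \notin s']).
have [us _] := H; apply: indep_on_perm H; apply: uniq_perm => //.
  rewrite cat_uniq us' filter_uniq// andbT /=.
  by apply/hasPn => x; rewrite mem_filter => /andP[].
move=> x; rewrite mem_cat mem_filter.
by case: (boolP (x \in s')) => //= /ss' ->.
Qed.

Lemma indep_on_cons i s B A : indep_on (i :: s) -> (forall i, measurable (B i)) ->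
  measurable A -> P (X i @^-1` A `&` rect s B) = (law i A * P (rect s B))%E.
Proof.
move=> H mB mA; rewrite indep_on_consE//.
by case: (indep_on_behead _ _ H) => _ ->.
Qed.

Lemma indep_on_pair i j s B (D : set (R * R)) : indep_on (i :: j :: s) ->
  (forall i, measurable (B i)) -> measurable D ->
  P ((fun t => (X i t, X j t)) @^-1` D `&` rect s B) =
  ((law i \x law j)%E D * P (rect s B))%E.
Proof.
move=> H mB mD; have Hj := indep_on_behead _ _ H.
apply: indep_extend => //; first exact: measurable_rect.
move=> A A' mA mA'; rewrite -setIA.
have [/= /andP[ij /andP[sj us]] _] := H.
have := indep_on_cons i (j :: s) (upd B j A') A H (mupd B j A' mB mA') mA.
rewrite rect_cons rect_upd// {1 2}/upd eqxx => ->.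
by rewrite indep_on_cons// muleA.
Qed.

(** Trades the three variables of one cell, its two incoming increments and its weight, for its two
    outgoing increments, next to bystanders [s]. Sweeping a rectangle repeats this move. *)
Lemma indep_on_burke i j k i' j' s (r q : R) (r0 : 0 < r) (q0 : 0 < q) :
  r + q = 1 -> indep_on (i :: j :: k :: s) ->
  i' != j' -> i' \notin s -> j' \notin s ->
  law i = expo r r0 -> law j = expo q q0 -> law k = expo 1 ltr01 ->
  law i' = expo r r0 -> law j' = expo q q0 ->
  (forall t, X i' t = X k t + Num.max (X i t - X j t) 0) ->
  (forall t, X j' t = X k t + Num.max (X j t - X i t) 0) ->
  indep_on (i' :: j' :: s).
Proof.
move=> rq H i'j' i's j's li lj lk li' lj' Xi' Xj'.
have Hk : indep_on (k :: s) by exact: (indep_on_catr [:: i; j]).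
have [_ Hs] := indep_on_behead _ _ Hk.
split; first by rewrite /= inE negb_or i'j' i's j's; case: Hk => /= /andP[].
move=> B mB; rewrite !big_cons -Hs// !rect_cons li' lj'.
rewrite muleA -(burke_local r q r0 q0 rq _ _ (mB i') (mB j')).
set D := [set _ | _].
have mD : measurable D.
  apply: measurableI.
    rewrite -[X in measurable X]setTI.
    apply: (_ : measurable_fun setT (fun q : (R * R) * R => q.2 + Num.max (q.1.1 - q.1.2) 0)) => //.
    apply: measurable_funD => //; apply: measurable_maxr => //.
    by apply: measurable_funB; apply: measurableT_comp.
  rewrite -[X in measurable X]setTI.
  apply: (_ : measurable_fun setT (fun q : (R * R) * R => q.2 + Num.max (q.1.2 - q.1.1) 0)) => //.
  apply: measurable_funD => //; apply: measurable_maxr => //.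
  by apply: measurable_funB; apply: measurableT_comp.
transitivity (P ((fun t => ((X i t, X j t), X k t)) @^-1` D `&` rect s B)).
  rewrite setIA; congr (P (_ `&` _)); rewrite /D.
  by apply/seteqP; split => t; rewrite /= Xi' Xj'.
apply: (indep_extend P (fun t => (X i t, X j t)) (X k)
  (expo r r0 \x expo q q0)%E (expo 1 ltr01) (rect s B)) => //.
- exact: measurable_fun_pair.
- exact: measurable_rect.
- move=> A C mA mC; rewrite -setIA.
  have [/and4P[_ _ ks _] _] := H.
  have := indep_on_pair i j (k :: s) (upd B k C) A H (mupd B k C mB mC) mA.
  rewrite rect_cons rect_upd// {1 2}/upd eqxx => ->.
  by rewrite indep_on_cons// li lj lk muleA.
Qed.

End independent_families.

(** * Exponential moments of sums *)

Section sums.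
Context {R : realType} {d : measure_display} {T : measurableType d}.
Context (P : probability T R) {I : eqType} (X : I -> T -> R).
Context (mX : forall i, measurable_fun setT (X i)).
Context (law : I -> probability R R).
Local Notation indep_on := (indep_on P X law).
Local Notation rect := (rect X).

Definition addp (p : R * R) : R := p.1 + p.2.

Lemma measurable_addp : measurable_fun setT addp.
Proof. exact: measurable_funD. Qed.

HB.instance Definition _ := isMeasurableFun.Build _ _ _ _ addp measurable_addp.

Lemma measurable_sumX s : measurable_fun setT (fun t => \sum_(i <- s) X i t).
Proof. exact: measurable_sum. Qed.

Lemma measurable_expRM (c : R) : measurable_fun setT (fun x : R => (expR (c * x))%:E).
Proof.
by apply/measurable_EFinP; apply: measurableT_comp => //; exact: measurable_funM.
Qed.

(* [nu] is the law of the sum; it is kept together with the independence of the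
   sum from the variables of [s'], so that summands can be merged one by one. *)
Lemma law_of_sum s s' (c : R) : indep_on (s ++ s') ->
  exists nu : probability R R,
    (forall A B, measurable A -> (forall i, measurable (B i)) ->
      P ((fun t => \sum_(i <- s) X i t) @^-1` A `&` rect s' B) =
      (nu A * P (rect s' B))%E) /\
    (\int[nu]_x (expR (c * x))%:E =
     \prod_(i <- s) \int[law i]_x (expR (c * x))%:E)%E.
Proof.
elim: s s' => [|i s IH] s' H.
  exists (@dirac _ R (0 : R) R : probability R R); split.
    move=> A B mA mB.
    have [A0|A0] := pselect (A 0).
      rewrite /= diracE mem_set// mul1e; congr (P _).
      by apply/seteqP; split => t //=; [case|rewrite big_nil].
    rewrite /= diracE memNset// mul0e (_ : _ `&` _ = set0) ?measure0//.
    by apply/seteqP; split => t //= []; rewrite big_nil.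
  rewrite big_nil integral_dirac//; last exact: measurable_expRM.
  by rewrite /= diracT mul1e mulr0 expR0.
have H' : indep_on (s ++ (i :: s')).
  by apply: indep_on_perm H; rewrite perm_sym perm_catC /= perm_cons perm_catC.
have His' : indep_on (i :: s') := indep_on_catr _ _ _ _ _ H'.
have [nu [nuE nuI]] := IH _ H'.
exists (distribution (law i \x nu : probability _ R)%E (addp : {mfun _ >-> _})); split.
  move=> A B mA mB.
  have mD : measurable (addp @^-1` A).
    by rewrite -[X in measurable X]setTI; exact: measurable_addp.
  have -> : (fun t => \sum_(j <- i :: s) X j t) @^-1` A =
     (fun t => (X i t, \sum_(j <- s) X j t)) @^-1` (addp @^-1` A).
    by apply/seteqP; split => t; rewrite /= /addp /= big_cons.
  apply: indep_extend => //; first exact: measurable_sumX.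
    exact: measurable_rect.
  move=> C C' mC mC'; rewrite -setIA setICA.
  have [/= /andP[is' us'] _] := His'.
  pose B' j := if j == i then C else B j.
  have mB' j : measurable (B' j) by rewrite /B'; case: eqP.
  have rB' : rect s' B' = rect s' B.
    apply: eq_rect => j js; rewrite /B'; case: eqP => // ji.
    by move: is'; rewrite -ji js.
  have := nuE _ B' mC' mB'; rewrite rect_cons rB' {1 2}/B' eqxx => ->.
  by rewrite (indep_on_cons P X law)// muleCA muleA.
have mA := measurable_expRM c.
rewrite (ge0_integral_pushforward measurable_addp)//.
rewrite preimage_setT.
rewrite (fubini_tonelli1 (m1 := law i) (m2 := nu)); last 2 first.
- by apply: measurableT_comp => //; exact: measurable_addp.
- by move=> x; rewrite lee_fin expR_ge0.
rewrite big_cons -nuI /fubini_F.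
under eq_integral => x _.
  rewrite (_ : (\int[nu]_y _)%E = ((expR (c * x))%:E * \int[nu]_y (expR (c * y))%:E)%E); last first.
    rewrite -ge0_integralZl//.
    by apply: eq_integral => y _; rewrite /= /addp /= mulrDr expRD EFinM.
  over.
by rewrite ge0_integralZr//; apply: integral_ge0 => x _; rewrite lee_fin expR_ge0.
Qed.

(** Exponential Markov inequality. The parameter [c] may be negative, so that the same bound serves
    both tails. *)
Lemma chernoff_expo s (l : R) (l0 : 0 < l) (c a : R) : indep_on s ->
  (forall i, i \in s -> law i = expo l l0) -> c < l ->
  (P [set t | (a <= c * \sum_(i <- s) X i t)%R] <=
   (expR (- a) * (l / (l - c)) ^+ size s)%R%:E)%E.
Proof.
move=> H ls cl.
have [|nu [nuE nuI]] := law_of_sum s [::] c; first by rewrite cats0.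
have mA : measurable [set x : R | a <= c * x].
  rewrite (_ : mkset _ = setT `&` (fun x => c * x) @^-1` `[a, +oo[%classic).
    exact: (measurable_funM (measurable_cst c) (@measurable_id _ _ setT)).
  by apply/seteqP; split => x /=; rewrite in_itv /= andbT => // -[].
have := nuE _ (fun=> setT) mA (fun=> measurableT).
rewrite (_ : rect [::] _ = setT); last by rewrite /rect set_nil bigcap_set0.
rewrite setIT probability_setT mule1 => ->.
have I0 : (\int[nu]_x (expR (c * x))%:E = ((l / (l - c)) ^+ size s)%:E)%E.
  rewrite nuI; elim: s ls {H nuE nuI} => [|i s IH] ls; first by rewrite big_nil.
  rewrite big_cons IH; last by move=> j js; apply: ls; rewrite inE js orbT.
  by rewrite ls ?inE ?eqxx// expo_mgf// -EFinM exprS.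
rewrite EFinM -I0 expRN lee_pdivlMl ?expR_gt0//.
rewrite -integral_cst//=.
apply: (@le_trans _ _ (\int[nu]_(x in [set x : R | (a <= c * x)%R]) (expR (c * x))%:E)%E).
  apply: ge0_le_integral => //.
  - by apply: measurable_funTS; exact: measurable_expRM.
  - by move=> x /= ax; rewrite lee_fin ler_expR.
by apply: ge0_subset_integral => //; exact: measurable_expRM.
Qed.

End sums.

Section order.
Context {R : realType}.
(** Given the first value [x], the second exceeds it with probability exp(- r x); as the rates add
    up to 1, what remains is [q] times an exponential density of rate 1. *)
Lemma expo_order (r q : R) (r0 : 0 < r) (q0 : 0 < q) : r + q = 1 ->
  (expo q q0 \x expo r r0)%E [set p | p.1 < p.2] = q%:E.
Proof.
move=> rq.
have mD : measurable [set p : R * R | p.1 < p.2].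
  rewrite (_ : mkset _ = setT `&` (fun p : R * R => p.2 - p.1) @^-1` `]0, +oo[%classic).
    by apply: (_ : measurable_fun setT (fun p : R * R => p.2 - p.1)) => //;
      exact: measurable_funB.
  by apply/seteqP; split => x /=; rewrite in_itv /= andbT subr_gt0 => // -[].
rewrite /product_measure1 /=.
rewrite integral_expo; last 2 first.
- by apply: measurable_fun_xsection.
- by move=> x; apply: measure_ge0.
transitivity (\int[lebesgue_measure]_x ((q)%:E * (exponential_pdf 1 x)%:E))%E.
  apply: eq_integral => x _.
  case: (ltP x 0) => x0; first by rewrite !lt0_exponential_pdf// !mule0.
  rewrite (_ : xsection _ _ = `]x, +oo[%classic); last first.
    by apply/seteqP; split => y; rewrite /xsection /= inE in_itv /= andbT.
  rewrite /= (expo_tail r r0 x x0) !exponential_pdfE// -!EFinM; congr EFin.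
  rewrite mulrCA -expRD mul1r; congr (_ * expR _).
  by rewrite -mulrDl -opprD rq.
rewrite ge0_integralZl//=.
- by rewrite integral_exponential_pdf// mule1.
- by apply/measurable_EFinP; exact: measurable_exponential_pdf.
- by move=> x _; rewrite lee_fin exponential_pdf_ge0.
- by rewrite lee_fin ltW.
Qed.
End order.

(** * Last passage percolation and the competition interface *)

Section last_passage.
Context {R : realFieldType}.
Implicit Types u V : nat -> nat -> R.

(** [G] in coordinates counted from the corner (see [G_lpp]). Points of the axes have a single
    predecessor and get their own equations, so that no weight off the quadrant enters. *)
Fixpoint lpp u (i : nat) : nat -> R :=
  match i with
  | 0 => fix row j := match j with 0 => u 0%N 0%N | j'.+1 => u 0%N j + row j' end
  | i'.+1 => fix row j := match j with
      | 0 => u i 0%N + lpp u i' 0%N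
      | j'.+1 => u i j + Num.max (lpp u i' j) (row j')
      end
  end.

Lemma lpp00 u : lpp u 0 0 = u 0%N 0%N. Proof. by []. Qed.
Lemma lppS0 u i : lpp u i.+1 0 = u i.+1 0%N + lpp u i 0. Proof. by []. Qed.
Lemma lpp0S u j : lpp u 0 j.+1 = u 0%N j.+1 + lpp u 0 j. Proof. by []. Qed.
Lemma lppSS u i j : lpp u i.+1 j.+1 =
  u i.+1 j.+1 + Num.max (lpp u i j.+1) (lpp u i.+1 j).
Proof. by []. Qed.

Arguments lpp : simpl never.

Lemma lpp_right u i j : u i.+1 j + lpp u i j <= lpp u i.+1 j.
Proof. by case: j => [|j]; rewrite ?lppS0 ?lppSS// lerD2l le_max lexx. Qed.

Lemma lpp_up u i j : u i j.+1 + lpp u i j <= lpp u i j.+1.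
Proof. by case: i => [|i]; rewrite ?lpp0S ?lppSS// lerD2l le_max lexx orbT. Qed.

(* Last passage times from [(1, 0)] to [(i + 1, j)] and from [(0, 1)] to
   [(i, j + 1)]. *)
Definition lppE u := lpp (fun i j => u i.+1 j).
Definition lppN u := lpp (fun i j => u i j.+1).

Lemma lppE0S u j : lppE u 0 j.+1 = u 1%N j.+1 + lppE u 0 j. Proof. by []. Qed.
Lemma lppES0 u i : lppE u i.+1 0 = u i.+2 0%N + lppE u i 0. Proof. by []. Qed.
Lemma lppESS u i j : lppE u i.+1 j.+1 =
  u i.+2 j.+1 + Num.max (lppE u i j.+1) (lppE u i.+1 j).
Proof. by []. Qed.
Lemma lppN0S u j : lppN u 0 j.+1 = u 0%N j.+2 + lppN u 0 j. Proof. by []. Qed.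
Lemma lppNS0 u i : lppN u i.+1 0 = u i.+1 1%N + lppN u i 0. Proof. by []. Qed.
Lemma lppNSS u i j : lppN u i.+1 j.+1 =
  u i.+1 j.+2 + Num.max (lppN u i j.+1) (lppN u i.+1 j).
Proof. by []. Qed.

Lemma lpp_firstS0 u i : lpp u i.+1 0 = u 0%N 0%N + lppE u i 0.
Proof.
elim: i => [|i IH]; first by rewrite lppS0 lpp00 addrC.
by rewrite lppS0 IH lppES0 addrCA.
Qed.

Lemma lpp_first0S u j : lpp u 0 j.+1 = u 0%N 0%N + lppN u 0 j.
Proof.
elim: j => [|j IH]; first by rewrite lpp0S lpp00 addrC.
by rewrite lpp0S IH lppN0S addrCA.
Qed.

(** Decomposes over the first step, whereas [lpp] recurses over the last one; the inductions only
    regroup maxima. *)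
Lemma lpp_firstSS u i j : lpp u i.+1 j.+1 =
  u 0%N 0%N + Num.max (lppE u i j.+1) (lppN u i.+1 j).
Proof.
elim: i j => [|i IHi]; elim => [|j IHj].
- by rewrite lppSS lpp_first0S lpp_firstS0 lppE0S lppNS0 -!addr_maxr addrCA maxC.
- rewrite lppSS lpp_first0S IHj lppNSS [in RHS]lppE0S -!addr_maxr addrCA.
  by rewrite maxCA.
- rewrite lppSS lpp_firstS0 IHi [in RHS]lppNS0 [in RHS]lppESS -!addr_maxr addrCA.
  by rewrite maxAC.
- by rewrite lppSS IHi IHj [in RHS]lppESS [in RHS]lppNSS -!addr_maxr addrCA maxACA.
Qed.

(** [lppE u i j.+1] and [lppN u i.+1 j] both end at [(i + 1, j + 1)]: their difference does not
    decrease to the right nor increase upwards. The usual reason is that two planar paths cross;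
    here the inequalities pass from cell to cell, each needing the other. *)
Lemma crossing u i j :
  lppN u i.+2 j - lppN u i.+1 j <= lppE u i.+1 j.+1 - lppE u i j.+1 /\
  lppE u i j.+2 - lppE u i j.+1 <= lppN u i.+1 j.+1 - lppN u i.+1 j.
Proof.
have baseE k : lppN u k.+2 0 - lppN u k.+1 0 <= lppE u k.+1 1 - lppE u k 1.
  rewrite lerBrDr lppNS0 addrK; exact: lpp_right.
have baseN k : lppE u 0 k.+2 - lppE u 0 k.+1 <= lppN u 1 k.+1 - lppN u 1 k.
  rewrite lerBrDr lppE0S addrK; exact: lpp_up.
have stepE k l :
    lppN u k.+2 l - lppN u k.+1 l <= lppE u k.+1 l.+1 - lppE u k l.+1 ->
    lppE u k l.+2 - lppE u k l.+1 <= lppN u k.+1 l.+1 - lppN u k.+1 l ->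
    lppN u k.+2 l.+1 - lppN u k.+1 l.+1 <= lppE u k.+1 l.+2 - lppE u k l.+2.
  move=> H1 H2; rewrite lppNSS [in X in _ <= X]lppESS.
  by case: (leP (lppN u k.+1 l.+1)); case: (leP (lppE u k l.+2)); lra.
have stepN k l :
    lppN u k.+2 l - lppN u k.+1 l <= lppE u k.+1 l.+1 - lppE u k l.+1 ->
    lppE u k l.+2 - lppE u k l.+1 <= lppN u k.+1 l.+1 - lppN u k.+1 l ->
    lppE u k.+1 l.+2 - lppE u k.+1 l.+1 <= lppN u k.+2 l.+1 - lppN u k.+2 l.
  move=> H1 H2; rewrite [in X in X <= _]lppESS [in X in _ <= X]lppNSS.
  by case: (leP (lppN u k.+1 l.+1)); case: (leP (lppE u k l.+2)); lra.
elim: i j => [|i IHi]; elim => [|j [IH1 IH2]]; split=> //.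
- exact: stepE.
- by have [] := IHi 0%N; exact: stepN.
- exact: stepE.
- by have [] := IHi j.+1; exact: stepN.
Qed.

Lemma crossing_right u i i' j : (i <= i')%N ->
  lppN u i.+1 j <= lppE u i j.+1 -> lppN u i'.+1 j <= lppE u i' j.+1.
Proof.
move=> /subnK <-; elim: (i' - i)%N => // n IH /IH.
by have [] := crossing u (n + i) j; rewrite addSn; lra.
Qed.

Lemma crossing_up u i j j' : (j <= j')%N ->
  lppE u i j.+1 < lppN u i.+1 j -> lppE u i j'.+1 < lppN u i.+1 j'.
Proof.
move=> /subnK <-; elim: (j' - j)%N => // n IH /IH.
by have [] := crossing u i (n + j); rewrite addSn; lra.
Qed.

(* Either step is allowed at a tie, which makes the notion invariant under
   transposition. *)
Definition weak_interface u (f : nat -> nat * nat) := f 0%N = (0, 0)%N /\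
  forall n, let: (x, y) := f n in
   f n.+1 = (x.+1, y) /\ lpp u x.+1 y <= lpp u x y.+1 \/
   f n.+1 = (x, y.+1) /\ lpp u x y.+1 <= lpp u x.+1 y.

(** [clusterE u x y] puts the right neighbour [(x + 1, y)] in the cluster of [(1, 0)], and
    [clusterN u x y] the upper neighbour [(x, y + 1)] in that of [(0, 1)], ties allowed. Neighbours
    on the axes are there trivially. *)
Let clusterE u x y := if y is y'.+1 then lppN u x.+1 y' <= lppE u x y else true.
Let clusterN u x y := if x is x'.+1 then lppE u x' y.+1 <= lppN u x y else true.

(** After a step to the right, the new right neighbour stays in its cluster by [crossing_right], and
    the new upper neighbour is best entered from the old upper one, which has the larger passage
    time. A step up is symmetric. *)
Lemma weak_interface_cluster u f : weak_interface u f -> forall n,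
  clusterE u (f n).1 (f n).2 /\ clusterN u (f n).1 (f n).2.
Proof.
rewrite /clusterE /clusterN => -[p0 H]; elim => [|n]; first by rewrite p0.
have := H n; case: (f n) => x y /= H' [IE IN].
case: H' => -[-> /= Hle]; split.
- case: y IE {IN Hle} => //= y; exact: crossing_right.
(* By the invariant these are, up to the corner weight, the passage times to [(x + 1, y)] and
   [(x, y + 1)], which the step has compared. *)
- have AB : lppE u x y <= lppN u x y.
    move: Hle; case: x IE IN => [|x]; case: y => [|y] /=.
    + by rewrite lpp_firstS0 lpp_first0S lerD2l.
    + rewrite lpp_first0S lpp_firstSS lerD2l ge_max => IE _ /andP[] //.
    + rewrite lpp_firstS0 lpp_firstSS lerD2l => _ IN; rewrite (max_r IN)//.
    + by rewrite !lpp_firstSS lerD2l => IE IN; rewrite (max_r IN) ge_max => /andP[].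
  have : lppE u x y.+1 <= u x.+1 y.+1 + lppN u x y.
    case: x AB IN {IE Hle} => [|x] AB IN; first by rewrite lppE0S lerD2l.
    by rewrite lppESS lerD2l ge_max AB IN.
  move/le_trans; apply; exact: lpp_right.
- have AB : lppN u x y <= lppE u x y.
    move: Hle; case: x IE IN => [|x]; case: y => [|y] /=.
    + by rewrite lpp_firstS0 lpp_first0S lerD2l.
    + rewrite lpp_first0S lpp_firstSS lerD2l => IE _; rewrite (max_l IE)//.
    + by rewrite lpp_firstS0 lpp_firstSS lerD2l ge_max => _ IN /andP[].
    + by rewrite !lpp_firstSS lerD2l => IE IN; rewrite (max_l IE) ge_max => /andP[].
  have : lppN u x.+1 y <= u x.+1 y.+1 + lppE u x y.
    case: y AB IE {IN Hle} => [|y] AB IE; first by rewrite lppNS0 lerD2l.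
    by rewrite lppNSS lerD2l ge_max AB IE.
  move/le_trans; apply; exact: lpp_up.
- case: x IN {IE Hle} => //= x.
  by have [_] := crossing u x y; lra.
Qed.

Lemma weak_interface_level u f n : weak_interface u f ->
  ((f n).1 + (f n).2 = n)%N.
Proof.
move=> [p0 H]; elim: n => [|n]; first by rewrite p0.
by have := H n; case: (f n) => x y /= [[-> _]|[-> _]] /=; lia.
Qed.

(** With [(a + 1, b + 1)] strictly in the cluster of [(0, 1)], the invariant forbids the interface
    to stand at height [b + 1] with abscissa at most [a], hence to rise above that height further
    left. At time [a.+1 + b.+1] it meets the antidiagonal of the point. *)
Lemma weak_interface_right u f a b : weak_interface u f ->
  lppE u a b.+1 < lppN u a.+1 b -> (a.+1 <= (f (a.+1 + b.+1)%N).1)%N.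
Proof.
move=> Hp ab.
suff H n : (b.+1 < (f n).2 -> a.+1 <= (f n).1)%N.
  have := weak_interface_level _ _ (a.+1 + b.+1)%N Hp; have := H (a.+1 + b.+1)%N; lia.
have [p0 Hs] := Hp.
elim: n => [|n]; first by rewrite p0.
have := weak_interface_cluster _ _ Hp n.
have := Hs n; case: (f n) => x y /= H' [IE _] IH.
case: H' => -[-> /= _]; first by move/IH; lia.
rewrite ltnS leq_eqVlt => /predU1P[by1|]; last exact: IH.
rewrite ltnNge; apply/negP => xa; move: IE; rewrite -by1 /=.
by move/(crossing_right _ _ _ _ xa); rewrite leNgt ab.
Qed.

(** Dynamic programming from the far sides: [V i j] is the best weight of a path from [(i, j)] until
    it leaves the box, plus the value of [V] where it leaves. *)
Definition backward u V a b := forall i j, (i <= a)%N -> (j <= b)%N ->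
  V i j = u i j + Num.max (V i.+1 j) (V i j.+1).

Lemma backward_ge u V a b i j : backward u V a b -> (i <= a)%N -> (j <= b)%N ->
  lpp u i j + V i.+1 j <= V 0%N 0%N /\ lpp u i j + V i j.+1 <= V 0%N 0%N.
Proof.
move=> HV ia jb.
(* The weight at [(i, j)] is counted in both [lpp u i j] and [V i j], hence the subtraction. *)
suff H : lpp u i j - u i j + V i j <= V 0%N 0%N.
  rewrite HV// in H.
  by split; apply: le_trans H; rewrite -addrA lerD2l addKr le_max lexx ?orbT.
have aux x y : (x <= a)%N -> (y <= b)%N -> lpp u x y - u x y + V x y <= V 0%N 0%N ->
  lpp u x y + V x.+1 y <= V 0%N 0%N /\ lpp u x y + V x y.+1 <= V 0%N 0%N.
  move=> xa yb H; rewrite HV// in H.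
  by split; apply: le_trans H; rewrite -addrA lerD2l addKr le_max lexx ?orbT.
elim: i ia j jb => [|i IHi] ia; elim => [|j IHj] jb.
- by rewrite lpp00 subrr add0r.
- rewrite lpp0S [u _ _ + _]addrC addrK.
  by have [] := aux _ _ ia (ltnW jb) (IHj (ltnW jb)).
- rewrite lppS0 [u _ _ + _]addrC addrK.
  by have [] := aux _ _ (ltnW ia) jb (IHi (ltnW ia) _ jb).
- rewrite lppSS [u _ _ + _]addrC addrK addr_maxl ge_max.
  have [_ ->] := aux _ _ ia (ltnW jb) (IHj (ltnW jb)).
  by have [->] := aux _ _ (ltnW ia) jb (IHi (ltnW ia) _ jb).
Qed.

(** Follows a maximising path, by induction on the number of steps left to the opposite corner of
    the box. *)
Lemma backward_exit u V a b : backward u V a b ->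
  (exists2 j, (j <= b)%N & V 0%N 0%N <= lpp u a j + V a.+1 j) \/
  (exists2 i, (i <= a)%N & V 0%N 0%N <= lpp u i b + V i b.+1).
Proof.
move=> HV.
suff H n i j : (n = (a - i) + (b - j))%N -> (i <= a)%N -> (j <= b)%N ->
    V 0%N 0%N <= lpp u i j - u i j + V i j ->
  (exists2 j, (j <= b)%N & V 0%N 0%N <= lpp u a j + V a.+1 j) \/
  (exists2 i, (i <= a)%N & V 0%N 0%N <= lpp u i b + V i b.+1).
  by apply: (H _ 0%N 0%N erefl) => //; rewrite lpp00 subrr add0r.
elim: n i j => [|n IH] i j nE ia jb Hij;
  have : V 0%N 0%N <= lpp u i j + Num.max (V i.+1 j) (V i j.+1)
    by apply: le_trans Hij _; rewrite (HV i j ia jb) -addrA lerD2l addKr.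
  have -> : i = a by lia.
  have -> : j = b by lia.
  by case: (leP (V a.+1 b)) => _ H; [right; exists a|left; exists b].
case: (leP (V i.+1 j)) => _ H.
- move: jb; rewrite leq_eqVlt => /predU1P[jb|jb]; first by right; exists i; rewrite -?jb.
  apply: (IH i j.+1) => //; first by lia.
  apply: le_trans H _; rewrite lerD2r lerBrDl; exact: lpp_up.
- move: ia; rewrite leq_eqVlt => /predU1P[ia|ia]; first by left; exists j; rewrite -?ia.
  apply: (IH i.+1 j) => //; first by lia.
  apply: le_trans H _; rewrite lerD2r lerBrDl; exact: lpp_right.
Qed.

(* If the optimal path for [V] starts upwards, it leaves the box either through
   the east side, which puts [(a + 1, b + 1)] in the cluster of [(0, 1)], or
   through the north side, where the larger north boundary of [V'] wins. *)
Lemma backward_compare u V V' a b :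
  backward u V a.+1 b.+1 -> backward u V' a.+1 b.+1 ->
  V 1%N 0%N < V 0%N 1%N ->
  (forall i, (i <= a.+1)%N ->
     V i b.+2 - V i.+1 b.+2 <= V' i b.+2 - V' i.+1 b.+2) ->
  lppE u a b.+1 < lppN u a.+1 b \/
  V 0%N 0%N - V a.+2 b.+2 <= V' 0%N 0%N - V' a.+2 b.+2.
Proof.
move=> HV HV' V10 HI.
(* Seen from [(0, 1)] or [(1, 0)], [V] is again a value function, for the shifted weights that
   define [lppN] and [lppE]. *)
have HN : backward (fun i j => u i j.+1) (fun i j => V i j.+1) a.+1 b.
  by move=> i j ia jb; exact: HV.
have HE : backward (fun i j => u i.+1 j) (fun i j => V i.+1 j) a b.+1.
  by move=> i j ia jb; exact: HV.
case: (backward_exit _ _ _ _ HN) => [[j jb Hj]|[i ia Hi]].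
  left; apply: (crossing_up _ _ _ _ jb).
  have [+ _] := backward_ge _ _ _ _ a j.+1 HE (leqnn _) jb.
  by rewrite -/(lppE u) => H; move: Hj; rewrite -/(lppN u); lra.
right.
have V00 : V 0%N 0%N = u 0%N 0%N + V 0%N 1%N by rewrite HV// max_r// ltW.
have LN : u 0%N 0%N + lppN u i b <= lpp u i b.+1.
  case: i {ia Hi} => [|i]; first by rewrite lpp_first0S.
  by rewrite lpp_firstSS lerD2l le_max lexx orbT.
(* [V'] may use the same path and exit, so the two values differ by at most what the boundary
   contributes between the exit and the corner [(a + 2, b + 2)]. *)
have [_ H'] := backward_ge _ _ _ _ i b.+1 HV' ia (leqnn _).
have tel : V i b.+2 - V a.+2 b.+2 <= V' i b.+2 - V' a.+2 b.+2.
  move: ia => /subnK; set n := (a.+1 - i)%N => nE.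
  have -> : a.+2 = (n.+1 + i)%N by lia.
  have : (n.+1 + i <= a.+2)%N by lia.
  elim: n.+1 => [|m IHm] H; first by rewrite add0n !subrr.
  have := IHm ltac:(lia); have := HI (m + i)%N ltac:(lia); rewrite addSn; lra.
move: Hi; rewrite -/(lppN u) /=; lra.
Qed.

End last_passage.
Arguments lpp : simpl never.

(** * The stationary field and its increments *)

Section stationary_field.
Context {R : realFieldType}.
Implicit Types (al be : nat -> R) (om : nat -> nat -> R).

(* [k] and [l] are counted from the corner of the box that carries the boundary
   weights; [backward_stat] reverses both coordinates. *)
Fixpoint stat al be om (k : nat) : nat -> R :=
  match k with
  | 0 => fix col l := match l with 0 => 0 | l'.+1 => col l' + be l' end
  | k'.+1 => fix col l := match l with
      | 0 => stat al be om k' 0%N + al k'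
      | l'.+1 => om k' l' + Num.max (stat al be om k' l) (col l')
      end
  end.

Definition incX al be om k l : R := stat al be om k.+1 l - stat al be om k l.
Definition incY al be om k l : R := stat al be om k l.+1 - stat al be om k l.

Lemma statSS al be om k l : stat al be om k.+1 l.+1 =
  om k l + Num.max (stat al be om k l.+1) (stat al be om k.+1 l).
Proof. by []. Qed.

Lemma incX0 al be om k : incX al be om k 0 = al k.
Proof. by rewrite /incX /= addrC addKr. Qed.

Lemma incY0 al be om l : incY al be om 0 l = be l.
Proof. by rewrite /incY /= addrC addKr. Qed.

Arguments stat : simpl never.

(** With [incYS], a closed recursion for the increments: the map of [burke_local]. *)
Lemma incXS al be om k l : incX al be om k l.+1 =
  om k l + Num.max (incX al be om k l - incY al be om k l) 0.
Proof.
rewrite /incX /incY statSS.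
case: (leP (stat al be om k l.+1) (stat al be om k.+1 l)) => H.
- by rewrite max_l; lra.
- by rewrite max_r; lra.
Qed.

Lemma incYS al be om k l : incY al be om k.+1 l =
  om k l + Num.max (incY al be om k l - incX al be om k l) 0.
Proof.
rewrite /incX /incY statSS.
case: (leP (stat al be om k l.+1) (stat al be om k.+1 l)) => H.
- by rewrite max_r; lra.
- by rewrite max_l; lra.
Qed.

(** An outgoing increment of a cell increases with the parallel incoming one and decreases with the
    other, so the order of the boundary weights propagates. *)
Lemma inc_monotone al be al' be' om : (forall k, al k <= al' k) ->
  (forall l, be' l <= be l) -> forall k l,
  incX al be om k l <= incX al' be' om k l /\ incY al' be' om k l <= incY al be om k l.
Proof.
move=> Ha Hb; elim=> [|k IHk]; elim=> [|l [IH1 IH2]]; rewrite ?incX0 ?incY0//.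
- split => //; rewrite !incXS lerD2l ge_max !le_max lexx orbT andbT.
  by apply/orP; left; move: IH1 IH2; rewrite !incY0; lra.
- have [H1 H2] := IHk 0%N.
  split => //; rewrite !incYS lerD2l ge_max !le_max lexx orbT andbT.
  by apply/orP; left; move: H1 H2; lra.
- have [H1 H2] := IHk l.+1.
  split; rewrite ?incXS ?[X in X <= _]incYS ?[X in _ <= X]incYS lerD2l ge_max !le_max lexx orbT andbT;
  apply/orP; left; lra.
Qed.

Lemma iota_rcons n : iota 0 n.+1 = rcons (iota 0 n) n.
Proof. by rewrite -addn1 iotaD cats1. Qed.

Lemma stat_incr al be om k l m n :
  stat al be om (k + m) (l + n) - stat al be om k l =
  \sum_(i <- iota 0 m) incX al be om (k + i) l +
  \sum_(j <- iota 0 n) incY al be om (k + m) (l + j).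
Proof.
have -> : \sum_(i <- iota 0 m) incX al be om (k + i) l =
   stat al be om (k + m) l - stat al be om k l.
  elim: m => [|m IH]; first by rewrite big_nil addn0 subrr.
  by rewrite iota_rcons big_rcons /= IH /incX addnS; lra.
have -> : \sum_(j <- iota 0 n) incY al be om (k + m) (l + j) =
   stat al be om (k + m) (l + n) - stat al be om (k + m) l.
  elim: n => [|n IH]; first by rewrite big_nil addn0 subrr.
  by rewrite iota_rcons big_rcons /= IH /incY addnS; lra.
by lra.
Qed.

(** Point [(i, j)] becomes [(M - i, M - j)], whose value uses the cell [(M.-1 - i, M.-1 - j)]; the
    strict bounds keep the truncated subtractions exact. *)
Lemma backward_stat al be u (M : nat) (a b : nat) : (a < M)%N -> (b < M)%N ->
  backward u (fun i j => stat al be (fun k l => u (M.-1 - k) (M.-1 - l))%N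
    (M - i)%N (M - j)%N) a b.
Proof.
move=> aM bM i j ia jb.
have -> : (M - i = (M.-1 - i).+1)%N by lia.
have -> : (M - j = (M.-1 - j).+1)%N by lia.
have -> : (M - i.+1 = M.-1 - i)%N by lia.
have -> : (M - j.+1 = M.-1 - j)%N by lia.
rewrite statSS; congr (_ + _); congr (u _ _); lia.
Qed.

End stationary_field.
Arguments stat : simpl never.

(** * Burke's property *)

Lemma count_cons {T : Type} (a : pred T) x s : count a (x :: s) = (a x + count a s)%N.
Proof. by []. Qed.

Lemma expo_scale {R : realType} (c : R) (c0 : 0 < c) (A : set R) : measurable A ->
  expo 1 ltr01 ((fun x => `|x| / c) @^-1` A) = expo c c0 A.
Proof.
move=> mA.
have mc : measurable_fun setT (fun x : R => `|x| / c).
  by apply: measurable_funM => //; exact: measurableT_comp.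
refine (measure_unique_tail (pushforward_measure (expo 1 ltr01) _ mc) (expo c c0) _ _ A mA).
  rewrite /pushforward_measure /= /pushforward preimage_setT (le_lt_trans (probability_le1 _ _))//.
  by rewrite ltry.
move=> t; rewrite /pushforward_measure /= /pushforward.
case: (leP 0 t) => t0; last first.
  rewrite (_ : _ @^-1` _ = setT) ?probability_setT ?expo_tail_lt0//.
  apply/seteqP; split => x //= _; rewrite in_itv /= andbT.
  by apply: lt_le_trans t0 _; rewrite divr_ge0// ltW.
have tc0 : 0 <= t * c by rewrite mulr_ge0// ltW.
have mS : measurable ((fun x : R => `|x| / c) @^-1` `]t, +oo[%classic).
  by rewrite -[X in measurable X]setTI; exact: mc.
transitivity (expo 1 ltr01 `]t * c, +oo[%classic); last first.
  by rewrite !expo_tail//; congr (expR _)%:E; lra.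
apply/eqP; rewrite eq_le; apply/andP; split; last first.
  apply: le_measure; rewrite ?inE// => x /=; rewrite !in_itv /= !andbT ltr_pdivlMr// => tx.
  by rewrite (lt_le_trans tx)// ler_norm.
apply: (@le_trans _ _ (expo 1 ltr01 (`]t * c, +oo[%classic `|` `]-oo, 0[%classic))).
  apply: le_measure; rewrite ?inE//; first exact: measurableU.
  move=> x /=; rewrite !in_itv /= !andbT ltr_pdivlMr//.
  by case: (ltP x 0) => x0; [right|rewrite ger0_norm//; left].
apply: (le_trans (measureU2 _ _ _)) => //.
by rewrite [X in (_ + X)%E](expo_lt0 1 ltr01) adde0.
Qed.

Section burke_field.
Context {R : realType} {d : measure_display} {T : measurableType d}.
Context (P : probability T R) (w : int * int -> T -> R).
Context (w_meas : forall z, measurable_fun setT (w z)).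
Context (w_exp : forall z (A : set R), measurable A ->
  P (w z @^-1` A) = exponential_prob (1 : R) A).
Context (w_indep : mutually_independent P w).
Context (M : nat).

Definition bulk (k l : nat) (t : T) : R :=
  w (Posz (M.-1 - k).+1, Posz (M.-1 - l).+1) t.
(* The boundary weights are rescaled copies of weights outside the quadrant; the
   absolute value makes them monotone in the rate everywhere and not just a.s. *)
Definition south (r : R) (k : nat) (t : T) : R := `|w (Posz k, (-1)%R) t| / r.
Definition west (q : R) (l : nat) (t : T) : R := `|w ((-1)%R, Posz l) t| / q.

Definition stat_field r q t := stat (south r ^~ t) (west q ^~ t) (fun k l => bulk k l t).
Definition field_incX r q k l t := stat_field r q t k.+1 l - stat_field r q t k l.
Definition field_incY r q k l t := stat_field r q t k l.+1 - stat_field r q t k l.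

Lemma measurable_stat_field r q k l : measurable_fun setT (fun t => stat_field r q t k l).
Proof.
have mal k' : measurable_fun setT (south r k').
  by apply: measurable_funM => //; exact: measurableT_comp.
have mbe l' : measurable_fun setT (west q l').
  by apply: measurable_funM => //; exact: measurableT_comp.
have mom k' l' : measurable_fun setT (bulk k' l') by exact: w_meas.
elim: k l => [|k IHk]; elim => [|l IHl].
- exact: measurable_cst.
- exact: (measurable_funD IHl (mbe l)).
- exact: (measurable_funD (IHk 0%N) (mal k)).
- exact: (measurable_funD (mom k l) (measurable_maxr (IHk l.+1) IHl)).
Qed.

Context (r q : R) (r0 : 0 < r) (q0 : 0 < q) (rq : r + q = 1).

(* [(k, l, b)] codes the horizontal increment at [(k, l)] if [b = 0], the vertical
   one if [b = 1] and the bulk weight otherwise. *)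
Definition field_var (i : nat * nat * nat) : T -> R :=
  let: (k, l, b) := i in
  match b with 0 => field_incX r q k l | 1 => field_incY r q k l | _ => bulk k l end%N.

Definition field_law (i : nat * nat * nat) : probability R R :=
  match i.2 with 0 => expo r r0 | 1 => expo q q0 | _ => expo 1 ltr01 end%N.

Lemma measurable_field_var i : measurable_fun setT (field_var i).
Proof.
case: i => [[k l] [|[|b]]] /=; try exact: w_meas;
by apply: measurable_funB; exact: measurable_stat_field.
Qed.

Definition rowX K l : seq (nat * nat * nat) := [seq (k, l, 0%N) | k <- iota 0 K].
Definition colY k L : seq (nat * nat * nat) := [seq (k, l, 1%N) | l <- iota 0 L].
Definition rowW K l : seq (nat * nat * nat) := [seq (k, l, 2%N) | k <- iota 0 K].
Definition allW K L := flatten [seq rowW K l | l <- iota 0 L].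

Local Notation indep := (indep_on P field_var field_law).

Let site (i : nat * nat * nat) : int * int :=
  let: (k, l, b) := i in
  match b with 0 => (Posz k, (-1)%R) | 1 => ((-1)%R, Posz l)
  | _ => (Posz (M.-1 - k).+1, Posz (M.-1 - l).+1) end%N.

Let scal (i : nat * nat * nat) (x : R) : R :=
  match i.2 with 0%N => `|x| / r | 1%N => `|x| / q | _ => x end.

(** These variables are rescaled weights at distinct sites; the bounds by [M] keep the truncated
    subtraction in [bulk] injective. *)
Lemma indep_boundary K L : (K <= M)%N -> (L <= M)%N ->
  indep (rowX K 0 ++ colY 0 L ++ allW K L).
Proof.
move=> KM LM; set s := _ ++ _.
have sP i : i \in s -> [\/ exists2 k, (k < K)%N & i = (k, 0, 0)%N,
   exists2 l, (l < L)%N & i = (0, l, 1)%N |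
   exists k l, [/\ (k < K)%N, (l < L)%N & i = (k, l, 2)%N]].
  rewrite /s !mem_cat => /or3P[/mapP[k]|/mapP[l]|/flattenP[_ /mapP[l + ->] /mapP[k]]].
  - by rewrite mem_iota => kK ->; apply: Or31; exists k.
  - by rewrite mem_iota => lL ->; apply: Or32; exists l.
  - by rewrite !mem_iota => lL kK ->; apply: Or33; exists k, l.
have us : uniq s.
  rewrite /s !cat_uniq !map_inj_uniq ?iota_uniq; try by move=> x y [].
  apply/and3P; split => //.
    apply/hasPn => x; rewrite mem_cat => /orP[/mapP[l _ ->]|/flattenP[_ /mapP[l _ ->] /mapP[k _ ->]]];
    by apply/mapP => -[? _].
  rewrite andTb; apply/andP; split.
    by apply/hasPn => x /flattenP[_ /mapP[l _ ->] /mapP[k _ ->]]; apply/mapP => -[? _].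
  by apply: allpairs_uniq; rewrite ?iota_uniq// => -[? ?] [? ?] _ _ [-> ->].
have sinj : {in s &, injective site}.
  move=> i j /sP[[k kK ->]|[l lL ->]|[k [l [kK lL ->]]]]
    /sP[[k' kK' ->]|[l' lL' ->]|[k' [l' [kK' lL' ->]]]] //= -[] //.
  - by move=> ->.
  - by move=> ->.
  - by move=> H1 H2; congr (_, _, _); lia.
have fieldE i : i \in s -> forall t, field_var i t = scal i (w (site i) t).
  move=> /sP[[k kK ->]|[l lL ->]|[k [l [kK lL ->]]]] t.
  - exact: incX0.
  - exact: incY0.
  - by [].
split => // B mB.
(* Carries each [B i] to its site. The inverse of [site] is a look-up in [s], as [site] is known to
   be injective only there. *)
pose B' (z : int * int) : set R := let i := nth (0, 0, 0)%N s (index z (map site s)) in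
   scal i @^-1` B i.
have B'E i : i \in s -> B' (site i) = scal i @^-1` B i.
  move=> si; rewrite /B'; set n := index _ _.
  have ns : (n < size s)%N by rewrite -(size_map site) index_mem map_f.
  have : site (nth (0, 0, 0)%N s n) = site i.
    by rewrite -(nth_map _ (site (0, 0, 0)%N))// nth_index// map_f.
  by move/sinj => ->//; exact: mem_nth.
have mB' z : measurable (B' z).
  rewrite /B' -[X in measurable X]setTI; move: (nth _ _ _) => i.
  apply: (_ : measurable_fun setT (scal i)) => //.
  rewrite /scal; case: i.2 => [|[|b]] //;
  by apply: measurable_funM => //; exact: measurableT_comp.
have u' : uniq (map site s) by rewrite map_inj_in_uniq.
have := w_indep (map site s) B' u' mB'.
rewrite big_map => H.
transitivity (P (\bigcap_(z in [set` map site s]) w z @^-1` B' z)).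
  congr (P _); apply/seteqP; split => t Ht.
    move=> z /= /mapP[i si ->]; rewrite /= B'E//= -fieldE//; exact: Ht.
  move=> i /= si; have := Ht (site i); rewrite /= B'E// => /(_ _)/=.
  by rewrite fieldE//; apply; exact: map_f.
rewrite H; apply: eq_big_seq => i si.
rewrite w_exp// B'E//.
rewrite -(expoE 1 ltr01) /field_law /scal.
by case: i.2 => [|[|b]] //; exact: expo_scale.
Qed.

(** Cell by cell, the vertical increment travels from column 0 to column [K] and each horizontal one
    rises by a level. The conditions on [rest] keep new variables from being listed twice. *)
Lemma indep_row K l rest :
  (forall k, (k, l.+1, 0)%N \notin rest) -> (forall k, (k, l, 1)%N \notin rest) ->
  indep (rowX K l ++ (0, l, 1)%N :: rowW K l ++ rest) ->
  indep (rowX K l.+1 ++ (K, l, 1)%N :: rest).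
Proof.
elim: K rest => [//|K IH] rest r1 r2 H.
have rS b : [seq (k, l, b) | k <- iota 0 K.+1] =
    rcons [seq (k, l, b) | k <- iota 0 K] (K, l, b) :> seq (nat * nat * nat).
  by rewrite iota_rcons map_rcons.
(* The horizontal increment and the weight of the last cell wait in the generalised [rest] while the
   first [K] cells are swept. *)
have H' : indep (rowX K l.+1 ++ (K, l, 1)%N :: [:: (K, l, 0)%N, (K, l, 2)%N & rest]).
  apply: IH.
- move=> k; apply/negP; rewrite !in_cons => /or3P[/eqP H1|/eqP H1|];
    [case: H1; lia|case: H1; lia|exact/negP/r1].
- move=> k; apply/negP; rewrite !in_cons => /or3P[/eqP H1|/eqP H1|];
    [case: H1; lia|case: H1; lia|exact/negP/r2].
- apply: indep_on_perm H; rewrite /rowX /rowW !rS.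
  by apply/permP => a; rewrite -!cats1 !(count_cat, count_cons) /=; lia.
pose s := rowX K l.+1 ++ rest.
have H2 : indep [:: (K, l, 0), (K, l, 1), (K, l, 2) & s]%N.
  apply: indep_on_perm H'.
  by apply/permP => a; rewrite /s !(count_cat, count_cons) /=; lia.
have H3 : indep [:: (K, l.+1, 0), (K.+1, l, 1) & s]%N.
  apply: (indep_on_burke P field_var measurable_field_var field_law _ _ _ _ _ _ _ _ r0 q0 rq H2) => //.
  - by apply/eqP => -[].
  - rewrite mem_cat negb_or r1 andbT; apply/mapP => -[k].
    by rewrite mem_iota => /andP[_ kK] [E]; move: kK; rewrite E add0n ltnn.
  - rewrite mem_cat negb_or r2 andbT; apply/mapP => -[k].
    by rewrite mem_iota.
  - by move=> t; exact: incXS.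
  - by move=> t; exact: incYS.
apply: indep_on_perm H3; rewrite /s /rowX iota_rcons map_rcons cat_rcons.
by apply/permP => a; rewrite !(count_cat, count_cons) /=; lia.
Qed.

(** Row by row from the bottom; [rest] holds the weights and vertical increments of the rows not yet
    reached. *)
Lemma indep_sweep K L rest :
  (forall i, i \in rest -> (i.2 = 2%N) \/ (i.2 = 1%N /\ (L <= i.1.2)%N)) ->
  indep (rowX K 0 ++ colY 0 L ++ allW K L ++ rest) ->
  indep (rowX K L ++ colY K L ++ rest).
Proof.
elim: L rest => [//|L IH] rest Hr H.
have cS k : colY k L.+1 = rcons (colY k L) (k, L, 1%N) by rewrite /colY iota_rcons map_rcons.
have aS : allW K L.+1 = allW K L ++ rowW K L.
  by rewrite /allW iota_rcons map_rcons flatten_rcons.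
have H1 : indep (rowX K L ++ colY K L ++ (0, L, 1)%N :: rowW K L ++ rest).
  apply: IH.
    move=> i; rewrite inE mem_cat => /or3P[/eqP ->|/mapP[k _ ->]|/Hr[->|[-> H']]].
    - by right.
    - by left.
    - by left.
    - by right; split => //; exact: ltnW.
  apply: indep_on_perm H; rewrite cS aS cat_rcons.
  by apply/permP => a; rewrite !(count_cat, count_cons) /=; lia.
have H2 : indep (rowX K L ++ (0, L, 1)%N :: rowW K L ++ (colY K L ++ rest)).
  apply: indep_on_perm H1.
  by apply/permP => a; rewrite !(count_cat, count_cons) /=; lia.
have H3 := indep_row K L _ _ _ H2.
rewrite cS cat_rcons.
apply: indep_on_perm (H3 _ _).
- by apply/permP => a; rewrite !(count_cat, count_cons) /=; lia.
- move=> k; rewrite mem_cat negb_or; apply/andP; split; first by apply/mapP => -[].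
  by apply/negP => /Hr /= [|[]].
- move=> k; rewrite mem_cat negb_or; apply/andP; split.
    by apply/mapP => -[l]; rewrite mem_iota => /andP[_ lL] [_ E]; move: lL; rewrite E add0n ltnn.
  by apply/negP => /Hr /= [//|[_]]; rewrite ltnn.
Qed.

(** The two increments at the corner [(K, L)] decide the first step of the value function; each
    side, for suitable [L], feeds the deviation bounds. *)
Theorem burke K L : (K <= M)%N -> (L <= M)%N -> indep (rowX K L ++ colY K L).
Proof.
move=> KM LM; rewrite -[colY K L]cats0; apply: indep_sweep => //.
by rewrite cats0; exact: indep_boundary.
Qed.

End burke_field.

(** * Exit point estimates *)

Lemma expRM_onem_le1 {R : realType} (x : R) : x < 1 -> expR x * (1 - x) <= 1.
Proof.
move=> x1; rewrite -[X in _ * X]opprK -(invrK (expR x)) mulrC ler_pdivrMr ?invr_gt0 ?expR_gt0//.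
by rewrite opprK mul1r -expRN; have := @expR_ge1Dx R (- x); lra.
Qed.

Section deviations.
Context {R : realType} {d : measure_display} {T : measurableType d}.
Context (P : probability T R).

(** The Chernoff parameters are proportional to [l], which frees [th] from the rate: one [th],
    chosen before the variables, serves all boxes and all parameters. *)
Lemma expo_deviation (eps : R) : 0 < eps < 1 ->
  exists2 th : R, 0 < th < 1 &
  forall (I : eqType) (X : I -> T -> R) (law : I -> probability R R)
    (s : seq I) (l : R) (l0 : 0 < l),
  (forall i, measurable_fun setT (X i)) -> indep_on P X law s ->
  (forall i, i \in s -> law i = expo l l0) ->
  (P [set t | ((1 + eps) * (size s)%:R / l <= \sum_(i <- s) X i t)%R] <= (th ^+ size s)%:E)%E /\
  (P [set t | (\sum_(i <- s) X i t <= (1 - eps) * (size s)%:R / l)%R] <= (th ^+ size s)%:E)%E.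
Proof.
move=> /andP[e0 e1].
(* Upper tail, parameter [c * l]: the exponent per variable is [c * (1 + eps) = eps / 2], and
   [1 / (1 - c) = 1 + eps / (2 + eps)] stays below exp(eps / 2). *)
pose c := eps / (2 * (1 + eps)).
have ce : c * (2 * (1 + eps)) = eps by rewrite /c divfK// gt_eqF//; lra.
have c0 : 0 < c by apply: divr_gt0 => //; nra.
have c1 : c < 1 by nra.
pose th1 := expR (- (eps / 2)) / (1 - c).
(* Lower tail, parameter [- eps * l]. *)
pose th2 := expR (eps * (1 - eps)) / (1 + eps).
have th1_1 : th1 < 1.
  rewrite /th1 ltr_pdivrMr ?mul1r; last by lra.
  rewrite expRN -[X in X < _]div1r ltr_pdivrMr ?expR_gt0//.
  have := @expR_ge1Dx R (eps / 2); nra.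
have th2_1 : th2 < 1.
  rewrite /th2 ltr_pdivrMr ?mul1r; last by lra.
  have x1 : 0 < 1 - eps * (1 - eps) by nra.
  rewrite -(ltr_pM2r x1); apply: (le_lt_trans (expRM_onem_le1 _ _)); first by lra.
  rewrite (_ : (1 + eps) * (1 - eps * (1 - eps)) = 1 + eps ^+ 3); last by ring.
  by rewrite ltrDl exprn_gt0.
have th1_0 : 0 < th1 by rewrite divr_gt0 ?expR_gt0//; lra.
have th2_0 : 0 < th2 by rewrite divr_gt0 ?expR_gt0//; lra.
exists (Num.max th1 th2).
  by rewrite lt_max th1_0 gt_max th1_1 th2_1.
move=> I X law s l l0 mX indX lawX.
split.
- rewrite (_ : mkset _ = [set t | ((eps / 2) * (size s)%:R <= (c * l) * \sum_(i <- s) X i t)%R]); last first.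
    have cl : 0 < c * l by exact: mulr_gt0.
    have E : (1 + eps) * (size s)%:R / l = (c * l)^-1 * (eps / 2 * (size s)%:R).
      have -> : eps / 2 = c * (1 + eps) by lra.
      by field; rewrite !gt_eqF.
    by apply/seteqP; split => t /=; rewrite E ler_pdivrMl.
  apply: (le_trans (chernoff_expo P X mX law s l l0 (c * l) _ indX lawX _)).
    by rewrite gtr_pMl.
  rewrite lee_fin -mulNr expRM_natr -exprMn lerXn2r ?nnegrE//.
  - by rewrite mulr_ge0 ?expR_ge0// divr_ge0 ?ltW//; nra.
  - by rewrite le_max ltW.
  - rewrite le_max; apply/orP; left; rewrite /th1 le_eqVlt; apply/orP; left; apply/eqP.
    by congr (_ * _); field; rewrite !gt_eqF ?subr_gt0 ?gtr_pMl//.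
- rewrite (_ : mkset _ = [set t | (- (eps * (1 - eps)) * (size s)%:R 
      <= (- eps * l) * \sum_(i <- s) X i t)%R]); last first.
    have el : 0 < eps * l by exact: mulr_gt0.
    have E : (1 - eps) * (size s)%:R / l = (eps * l)^-1 * ((eps * (1 - eps)) * (size s)%:R).
      by field; rewrite !gt_eqF.
    by apply/seteqP; split => t /=; rewrite !mulNr lerN2 E ler_pdivlMl.
  apply: (le_trans (chernoff_expo P X mX law s l l0 (- eps * l) _ indX lawX _)).
    by nra.
  rewrite lee_fin -mulNr opprK expRM_natr -exprMn lerXn2r ?nnegrE//.
  - by rewrite mulr_ge0 ?expR_ge0// divr_ge0 ?ltW//; nra.
  - by rewrite le_max ltW.
  - rewrite le_max; apply/orP; right; rewrite /th2 le_eqVlt; apply/orP; left; apply/eqP.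
    by congr (_ * _); field; rewrite !gt_eqF//; nra.
Qed.

End deviations.

Section exit.
Context {R : realType} {d : measure_display} {T : measurableType d}.
Context (P : probability T R) (w : int * int -> T -> R).
Context (w_meas : forall z, measurable_fun setT (w z)).
Context (w_exp : forall z (A : set R), measurable A ->
  P (w z @^-1` A) = exponential_prob (1 : R) A).
Context (w_indep : mutually_independent P w).

(** In the coordinates of the box, [V 0 0 - V m n] for the stationary value function [V] of
    parameter [r]. *)
Definition jump (M : nat) (r : R) (m n : nat) (t : T) : R :=
  stat_field w M r (1 - r) t M M - stat_field w M r (1 - r) t (M - m)%N (M - n)%N.

Lemma measurable_jump M r m n : measurable_fun setT (jump M r m n).
Proof. by apply: measurable_funB; exact: measurable_stat_field. Qed.

Let segX M m n : seq (nat * nat * nat) := [seq ((M - m + i)%N, (M - n)%N, 0%N) | i <- iota 0 m].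
Let segY M n : seq (nat * nat * nat) := [seq (M, (M - n + j)%N, 1%N) | j <- iota 0 n].

Lemma jumpE M r m n t : (m <= M)%N -> (n <= M)%N ->
  jump M r m n t = \sum_(i <- segX M m n) field_var w M r (1 - r) i t +
                   \sum_(i <- segY M n) field_var w M r (1 - r) i t.
Proof.
move=> mM nM; rewrite /jump !big_map.
have := stat_incr (south w r ^~ t) (west w (1 - r) ^~ t) (fun k l => bulk w M k l t)
  (M - m) (M - n) m n.
by rewrite !subnK.
Qed.

(** The horizontal and vertical parts of [jumpE] follow the bottom and the right side of a
    rectangle, so [burke] makes each an independent family but not the two together; a union bound
    joins them. *)
Lemma jump_deviation (eps : R) : 0 < eps < 1 -> exists2 th : R, 0 < th < 1 &
  forall M r m n, 0 < r < 1 -> (m <= M)%N -> (n <= M)%N ->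
  (P [set t | ((1 + eps) * (m%:R / r + n%:R / (1 - r)) <= jump M r m n t)%R] <=
    (th ^+ m + th ^+ n)%R%:E)%E /\
  (P [set t | (jump M r m n t <= (1 - eps) * (m%:R / r + n%:R / (1 - r)))%R] <=
    (th ^+ m + th ^+ n)%R%:E)%E.
Proof.
move=> /(expo_deviation P) [th th01 H]; exists th => // M r m n /andP[r0 r1] mM nM.
have q0 : 0 < 1 - r by rewrite subr_gt0.
have rq : r + (1 - r) = 1 by lra.
pose fld := field_var w M r (1 - r).
have mf i : measurable_fun setT (fld i) by exact: measurable_field_var.
have iX : indep_on P fld (field_law r (1 - r) r0 q0) (segX M m n).
  apply: (indep_on_sub _ _ _ (rowX M (M - n) ++ colY M (M - n))).
  - by rewrite map_inj_uniq ?iota_uniq// => x y [] /addnI.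
  - move=> x /mapP[i]; rewrite mem_iota => /andP[_ im] ->; rewrite mem_cat; apply/orP; left.
    by apply/mapP; exists (M - m + i)%N => //; rewrite mem_iota; lia.
  - exact: (burke P w w_meas w_exp w_indep M r (1 - r) r0 q0 rq M (M - n) (leqnn _) (leq_subr _ _)).
have iY : indep_on P fld (field_law r (1 - r) r0 q0) (segY M n).
  apply: (indep_on_sub _ _ _ (rowX M M ++ colY M M)).
  - by rewrite map_inj_uniq ?iota_uniq// => x y [] /addnI.
  - move=> x /mapP[i]; rewrite mem_iota => /andP[_ im] ->; rewrite mem_cat; apply/orP; right.
    by apply/mapP; exists (M - n + i)%N => //; rewrite mem_iota; lia.
  - exact: (burke P w w_meas w_exp w_indep M r (1 - r) r0 q0 rq M M (leqnn _) (leqnn _)).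
have [] := H _ fld _ _ r r0 mf iX.
  by move=> _ /mapP[i _ ->].
have [] := H _ fld _ _ (1 - r) q0 mf iY.
  by move=> _ /mapP[i _ ->].
rewrite !size_map !size_iota => HY1 HY2 HX1 HX2.
have ms (s : seq (nat * nat * nat)) : measurable_fun setT (fun t => \sum_(i <- s) fld i t).
  exact: measurable_sum.
have mge (s : seq (nat * nat * nat)) (a : R) :
    measurable [set t | (a <= \sum_(i <- s) fld i t)%R].
  rewrite (_ : mkset _ = (fun t => \sum_(i <- s) fld i t) @^-1` `[a, +oo[%classic).
    by apply: measurable_preim.
  by apply/seteqP; split => t /=; rewrite in_itv /= andbT.
have mle (s : seq (nat * nat * nat)) (a : R) :
    measurable [set t | (\sum_(i <- s) fld i t <= a)%R].
  rewrite (_ : mkset _ = (fun t => \sum_(i <- s) fld i t) @^-1` `]-oo, a]%classic).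
    by apply: measurable_preim.
  by apply/seteqP; split => t /=; rewrite in_itv /=.
have mj := measurable_jump M r m n.
have U (A B C : set T) (a b : R) : measurable A -> measurable B -> measurable C ->
   C `<=` A `|` B -> (P A <= a%:E)%E -> (P B <= b%:E)%E -> (P C <= (a + b)%R%:E)%E.
  move=> mA mB mC CAB PA PB; rewrite EFinD; apply: le_trans (leeD PA PB).
  apply: (le_trans (le_measure P _ _ CAB)); rewrite ?inE//; first exact: measurableU.
  exact: measureU2.
split.
- apply: (U _ _ _ _ _ _ _ _ _ HX1 HY1) => //.
    rewrite (_ : mkset _ = jump M r m n @^-1` `[(1 + eps) * (m%:R / r + n%:R / (1 - r)), +oo[%classic).
      exact: measurable_preim.
    by apply/seteqP; split => t /=; rewrite in_itv /= andbT.
  move=> t /=; rewrite jumpE// -/fld => Ht.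
  case: (leP ((1 + eps) * m%:R / r) (\sum_(i <- segX M m n) fld i t)) => H1; first by left.
  by right; lra.
- apply: (U _ _ _ _ _ _ _ _ _ HX2 HY2) => //.
    rewrite (_ : mkset _ = jump M r m n @^-1` `]-oo, (1 - eps) * (m%:R / r + n%:R / (1 - r))]%classic).
      exact: measurable_preim.
    by apply/seteqP; split => t /=; rewrite in_itv /=.
  move=> t /=; rewrite jumpE// -/fld => Ht.
  case: (leP (\sum_(i <- segX M m n) fld i t) ((1 - eps) * m%:R / r)) => H1; first by left.
  by right; lra.
Qed.

Lemma measurable_jump_le M r lam m n : measurable [set t | jump M r m n t <= jump M lam m n t].
Proof.
rewrite (_ : mkset _ = (fun t => jump M lam m n t - jump M r m n t) @^-1` `[0, +oo[%classic).
  by apply: measurable_preim => //; apply: measurable_funB; exact: measurable_jump.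
by apply/seteqP; split => t /=; rewrite in_itv /= andbT subr_ge0.
Qed.

Lemma exit_estimate (p q : nat) (r lam : R) : (0 < p)%N -> (0 < q)%N ->
  0 < lam < 1 -> 0 < r < 1 ->
  p%:R / lam + q%:R / (1 - lam) < p%:R / r + q%:R / (1 - r) ->
  exists th : R, exists N0 : nat, 0 < th < 1 /\
  forall N M, (N0 <= N)%N -> ((N * p).+1 <= M)%N -> ((N * q).+1 <= M)%N ->
  (P [set t | (jump M r (N * p).+1 (N * q).+1 t <= jump M lam (N * p).+1 (N * q).+1 t)%R]
    <= (4 * th ^+ N)%R%:E)%E.
Proof.
move=> p0 q0 lam01 r01.
set hl := _ + _; set hr := _ + _ => hlr.
have hl0 : 0 < hl.
  by case/andP: lam01 => l0 l1; rewrite addr_gt0// divr_gt0 ?ltr0n// subr_gt0.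
(* Makes [(1 - eps) * hr - (1 + eps) * hl] three quarters of [hr - hl]. *)
pose eps := (hr - hl) / (4 * (hr + hl)).
have hh : 0 < hr + hl by lra.
have ehh : eps * (4 * (hr + hl)) = hr - hl by rewrite /eps divfK// gt_eqF//; lra.
have e0 : 0 < eps by rewrite divr_gt0//; lra.
have e1 : eps < 1 by nra.
have [th th01 H] := jump_deviation eps (introT andP (conj e0 e1)).
case/andP: (th01) => th0 th1.
pose al := (1 - eps) / r - (1 + eps) / lam.
pose be := (1 - eps) / (1 - r) - (1 + eps) / (1 - lam).
have ab : 0 < al * p%:R + be * q%:R.
  have -> : al * p%:R + be * q%:R = (1 - eps) * hr - (1 + eps) * hl.
    by rewrite /al /be /hr /hl; ring.
  by nra.
(* Absorbs the constant [al + be] due to the successors in [(N * p).+1] and [(N * q).+1]. *)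
pose N0 := (Num.truncn (`|al + be| / (al * p%:R + be * q%:R))).+1.
exists th, N0; split => // N M N0N mM nM.
set m := (N * p).+1; set n := (N * q).+1.
have key : (1 + eps) * (m%:R / lam + n%:R / (1 - lam)) < (1 - eps) * (m%:R / r + n%:R / (1 - r)).
  rewrite -subr_gt0 (_ : _ - _ = N%:R * (al * p%:R + be * q%:R) + (al + be)); last first.
    by rewrite /m /n /al /be -!natr1 !natrM; ring.
  have : `|al + be| < N%:R * (al * p%:R + be * q%:R).
    rewrite -ltr_pdivrMr//; apply: lt_le_trans (truncnS_gt _) _.
    by rewrite ler_nat.
  by have := ler_norm (- (al + be)); rewrite normrN; lra.
have [H1 _] := H M lam m n lam01 mM nM.
have [_ H2] := H M r m n r01 mM nM.
have thN k : (N <= k)%N -> th ^+ k <= th ^+ N.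
  by move=> Nk; rewrite ler_wiXn2l// ltW.
have thm : th ^+ m <= th ^+ N by apply: thN; rewrite /m leqW// leq_pmulr.
have thn : th ^+ n <= th ^+ N by apply: thN; rewrite /n leqW// leq_pmulr.
apply: (@le_trans _ _ ((th ^+ m + th ^+ n)%R%:E + (th ^+ m + th ^+ n)%R%:E)%E); last first.
  by rewrite -EFinD lee_fin; lra.
apply: le_trans (leeD H1 H2).
have mA := measurable_preim (jump M lam m n)
   `[(1 + eps) * (m%:R / lam + n%:R / (1 - lam)), +oo[%classic
   (measurable_jump M lam m n) (measurable_itv _).
have mB := measurable_preim (jump M r m n)
   `]-oo, (1 - eps) * (m%:R / r + n%:R / (1 - r))]%classic
   (measurable_jump M r m n) (measurable_itv _).
rewrite (_ : [set t | ((1 + eps) * _ <= _)%R] = jump M lam m n @^-1`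
  `[(1 + eps) * (m%:R / lam + n%:R / (1 - lam)), +oo[%classic); last first.
  by apply/seteqP; split => t /=; rewrite in_itv /= andbT.
rewrite [X in (_ <= _ + P X)%E](_ : _ = jump M r m n @^-1`
  `]-oo, (1 - eps) * (m%:R / r + n%:R / (1 - r))]%classic); last first.
  by apply/seteqP; split => t /=; rewrite in_itv /=.
apply: le_trans (measureU2 _ mA mB).
apply: le_measure; rewrite ?inE; [exact: measurable_jump_le|exact: measurableU|].
move=> t /= Ht; rewrite !in_itv /= andbT.
case: (leP ((1 + eps) * (m%:R / lam + n%:R / (1 - lam))) (jump M lam m n t)) => ?; first by left.
by right; lra.
Qed.

End exit.

Definition quadrant {R : realType} {T : Type} (w : int * int -> T -> R) (t : T)
  (i j : nat) : R := w (Posz i.+1, Posz j.+1) t.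

(** * Probability of passing to the right of a ray *)

Section interface_right.
Context {R : realType} {d : measure_display} {T : measurableType d}.
Context (P : probability T R) (w : int * int -> T -> R).
Context (w_meas : forall z, measurable_fun setT (w z)).
Context (w_exp : forall z (A : set R), measurable A ->
  P (w z @^-1` A) = exponential_prob (1 : R) A).
Context (w_indep : mutually_independent P w).

Definition starts_up M r :=
  [set t | stat_field w M.+1 r (1 - r) t M M.+1 < stat_field w M.+1 r (1 - r) t M.+1 M].

Lemma measurable_starts_up M r : measurable (starts_up M r).
Proof.
rewrite (_ : starts_up M r = (fun t => stat_field w M.+1 r (1 - r) t M.+1 M -
   stat_field w M.+1 r (1 - r) t M M.+1) @^-1` `]0, +oo[%classic).
  by apply: measurable_preim => //; apply: measurable_funB; exact: measurable_stat_field.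
by apply/seteqP; split => t /=; rewrite in_itv /= andbT subr_gt0.
Qed.

(** At the corner [(M.+1, M.+1)] the vertical increment has to be smaller than the horizontal one;
    they are independent of rates [1 - r] and [r], whatever [M] is. *)
Lemma starts_up_prob M r : 0 < r < 1 -> P (starts_up M r) = (1 - r)%:E.
Proof.
move=> /andP[r0 r1].
have q0 : 0 < 1 - r by rewrite subr_gt0.
have rq : r + (1 - r) = 1 by lra.
pose fld := field_var w M.+1 r (1 - r).
have mf i : measurable_fun setT (fld i) by exact: measurable_field_var.
have H : indep_on P fld (field_law r (1 - r) r0 q0) [:: (M.+1, M, 1%N); (M, M.+1, 0%N)].
  apply: (indep_on_sub _ _ _ (rowX M.+1 M.+1 ++ colY M.+1 M.+1)).
  - by rewrite cons_uniq mem_seq1; apply/andP; split => //; apply/eqP => -[].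
  - move=> x xs; rewrite mem_cat; apply/orP.
    move: xs; rewrite in_cons mem_seq1 => /orP[/eqP->|/eqP->].
      by right; apply/mapP; exists M => //; rewrite mem_iota; lia.
    by left; apply/mapP; exists M => //; rewrite mem_iota; lia.
  - exact: (burke P w w_meas w_exp w_indep M.+1 r (1 - r) r0 q0 rq _ _ (leqnn _) (leqnn _)).
have mD : measurable [set p : R * R | p.1 < p.2].
  rewrite (_ : mkset _ = setT `&` (fun p : R * R => p.2 - p.1) @^-1` `]0, +oo[%classic).
    by apply: (_ : measurable_fun setT (fun p : R * R => p.2 - p.1)) => //;
      exact: measurable_funB.
  by apply/seteqP; split => x /=; rewrite in_itv /= andbT subr_gt0 => // -[].
have := indep_on_pair P fld mf _ _ _ [::] (fun=> setT) _ H (fun=> measurableT) mD.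
rewrite (_ : rect _ _ _ = setT); last by rewrite /rect set_nil bigcap_set0.
rewrite setIT probability_setT mule1 /field_law /=.
rewrite (expo_order r (1 - r) r0 q0 rq) => <-; congr (P _).
by apply/seteqP; split => t; rewrite /starts_up /= /field_incX /field_incY; lra.
Qed.

(** The fields of parameters [r] and [lam] share the bulk and have ordered boundaries, so the
    excluded inequality is the second alternative of [backward_compare]. *)
Lemma interface_right_of_not_bad (M : nat) (r lam : R) (m n : nat) (t : T) f :
  0 < lam -> lam < r -> r < 1 -> (m.+2 <= M.+1)%N -> (n.+2 <= M.+1)%N ->
  weak_interface (quadrant w t) f -> starts_up M r t ->
  ~ (jump w M.+1 r m.+2 n.+2 t <= jump w M.+1 lam m.+2 n.+2 t) ->
  (m.+1 <= (f (m.+1 + n.+1)%N).1)%N.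
Proof.
move=> lam0 lamr r1 mM nM Hf Hup Hbad.
apply: (weak_interface_right _ _ _ _ Hf).
pose V r (i j : nat) := stat_field w M.+1 r (1 - r) t (M.+1 - i)%N (M.+1 - j)%N.
have bV r' : backward (quadrant w t) (V r') m.+1 n.+1 by apply: backward_stat.
case: (backward_compare _ _ _ _ _ (bV r) (bV lam)) => //.
- by rewrite /V subn0 subn1.
- move=> i im; rewrite /V.
  have -> : (M.+1 - i = (M.+1 - i.+1).+1)%N by lia.
  have Hs k : south w r k t <= south w lam k t.
    by rewrite ler_wpM2l// lef_pV2 ?posrE//; lra.
  have Hw l : west w (1 - lam) l t <= west w (1 - r) l t.
    by rewrite ler_wpM2l// lef_pV2 ?posrE//; lra.
  by have [] := inc_monotone _ _ _ _ (fun k l => bulk w M.+1 k l t) Hs Hw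
    (M.+1 - i.+1)%N (M.+1 - n.+2)%N.
Qed.

(** [N1] comes before [K]: a geometric tail bounds the bad events over windows of any length,
    whereas [F] lives in a box that grows with [K]. *)
Theorem interface_right_prob (f : T -> nat -> nat * nat) (p q : nat) (r e : R) :
  (forall t, weak_interface (quadrant w t) (f t)) ->
  (0 < p)%N -> (0 < q)%N -> 0 < r < 1 ->
  p%:R * (1 - r) ^+ 2 < q%:R * r ^+ 2 -> 0 < e ->
  exists N1 : nat, forall K, exists F : set T,
  [/\ measurable F, ((1 - r - e)%R%:E <= P F)%E &
    forall t, F t -> forall N, (N1 <= N < N1 + K)%N ->
      (N * p <= (f t (N * p + N * q)%N).1)%N].
Proof.
move=> Hf p0 q0 r01 pqr e0; case/andP: (r01) => r0 r1.
have p0' : 0 < p%:R :> R by rewrite ltr0n.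
have q0' : 0 < q%:R :> R by rewrite ltr0n.
pose D := q%:R * r + p%:R * (1 - r).
have D0 : 0 < D by rewrite addr_gt0// mulr_gt0// subr_gt0.
(* The exit estimate needs [p (1 - r) (1 - lam) < q r lam], which holds strictly
   between the root [p (1 - r) / D] of this linear condition and [r]. *)
pose lam := (p%:R * (1 - r) / D + r) / 2.
have lamD : lam * D = (p%:R * (1 - r) + r * D) / 2.
  by rewrite /lam; field; rewrite gt_eqF.
have lam0 : 0 < lam.
  by rewrite divr_gt0// addr_gt0// divr_gt0// mulr_gt0// subr_gt0.
have lamr : lam < r by rewrite -(ltr_pM2r D0) lamD /D; nra.
have l1 : 0 < 1 - lam by lra.
have l2 : 0 < 1 - r by lra.
have gl : 0 < q%:R * r * lam - p%:R * (1 - r) * (1 - lam).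
  have -> : q%:R * r * lam - p%:R * (1 - r) * (1 - lam) = lam * D - p%:R * (1 - r).
    by rewrite /D; ring.
  by rewrite lamD /D; nra.
have hlr : p%:R / lam + q%:R / (1 - lam) < p%:R / r + q%:R / (1 - r).
  have diffE : p%:R / r + q%:R / (1 - r) - (p%:R / lam + q%:R / (1 - lam)) =
      (r - lam) * (q%:R * r * lam - p%:R * (1 - r) * (1 - lam)) /
      (r * lam * (1 - r) * (1 - lam)).
    by field; rewrite !gt_eqF.
  rewrite -subr_gt0 diffE; apply: divr_gt0; last by do 3?apply: mulr_gt0.
  by apply: mulr_gt0 => //; lra.
have lam01 : 0 < lam < 1 by rewrite lam0; lra.
have [th [N0 [/andP[th0 th1] Hth]]] :=
  exit_estimate P w w_meas w_exp w_indep p q r lam p0 q0 lam01 r01 hlr.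
have [N2 HN2] : exists N2, 4 * th ^+ N2 / (1 - th) <= e.
  have e' : 0 < e * (1 - th) / 4 by rewrite divr_gt0// mulr_gt0// subr_gt0.
  have /cvgrPdist_lt/(_ _ e')[N2 _ HN2] : (fun n => th ^+ n) @ \oo --> (0 : R).
    by apply: cvg_expr; rewrite gtr0_norm.
  exists N2; have := HN2 N2 (leqnn _).
  rewrite /= sub0r normrN ger0_norm; last by rewrite exprn_ge0// ltW.
  by move=> H; rewrite ler_pdivrMr ?subr_gt0//; lra.
pose N1 := (maxn N0 N2).+1; exists N1 => K.
have N1N0 : (N0 <= N1)%N by rewrite leqW// leq_maxl.
have N1N2 : (N2 <= N1)%N by rewrite leqW// leq_maxr.
pose M := ((N1 + K) * p + (N1 + K) * q)%N.
pose bad i := [set t | jump w M.+1 r ((N1 + i) * p).+1 ((N1 + i) * q).+1 t <=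
                       jump w M.+1 lam ((N1 + i) * p).+1 ((N1 + i) * q).+1 t].
have mbad i : measurable (bad i) by exact: measurable_jump_le.
pose BAD := \big[setU/set0]_(i < K) bad i.
have mBAD : measurable BAD by exact: bigsetU_measurable.
have Pbad i : (i < K)%N -> (P (bad i) <= (4 * th ^+ (N1 + i))%R%:E)%E.
  move=> iK; apply: Hth.
  - exact: leq_trans N1N0 (leq_addr _ _).
  - by rewrite ltnS /M -[X in (X <= _)%N]addn0 leq_add// leq_mul2r leq_add2l (ltnW iK) orbT.
  - by rewrite ltnS /M -[X in (X <= _)%N]add0n leq_add// leq_mul2r leq_add2l (ltnW iK) orbT.
have PBAD : (P BAD <= e%:E)%E.
  apply: (le_trans (@Boole_inequality _ _ _ P bad K (fun i _ => mbad i))).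
  apply: (@le_trans _ _ (\sum_(i < K) (4 * th ^+ (N1 + i))%R%:E)%E).
    by apply: lee_sum => i _; exact: Pbad.
  rewrite sumEFin lee_fin; apply: le_trans HN2.
  rewrite ler_pdivlMr ?subr_gt0//.
  have -> : (\sum_(i < K) 4 * th ^+ (N1 + i)) * (1 - th) = 4 * th ^+ N1 * (1 - th ^+ K).
    elim: K {M bad mbad BAD mBAD Pbad} => [|K IH].
      by rewrite big_ord0 mul0r expr0 subrr mulr0.
    by rewrite big_ord_recr/= mulrDl IH exprD exprS; ring.
  have : th ^+ N1 <= th ^+ N2 by rewrite ler_wiXn2l// ltW.
  have : 0 <= th ^+ K <= 1 by rewrite exprn_ge0 ?exprn_ile1 ?ltW.
  have : 0 <= th ^+ N1 by rewrite exprn_ge0// ltW.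
  by move=> ? /andP[? ?] ?; nra.
exists (starts_up M r `\` BAD); split.
- by apply: measurableD => //; exact: measurable_starts_up.
- have mS := measurable_starts_up M r.
  have : (P (starts_up M r) <= P (starts_up M r `\` BAD) + P BAD)%E.
    apply: le_trans (measureU2 _ _ _); [|exact: measurableD|by []].
    apply: le_measure; rewrite ?inE//; first by apply: measurableU => //; exact: measurableD.
    by move=> t St; case: (pselect (BAD t)) => Bt; [right|left].
  rewrite starts_up_prob// => H.
  have := le_trans H (leeD (lexx _) PBAD).
  by move=> H2; rewrite EFinB leeBlDr.
- move=> t [St nB] N /andP[N1N NK].
  have N0' : (0 < N)%N by exact: leq_trans N1N.
  have NM b : (0 < b)%N -> (N * b < (N1 + K) * b)%N by move=> b0; rewrite ltn_mul2r b0.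
  have Np : (N * p).-1.+1 = (N * p)%N by rewrite prednK// muln_gt0 p0 N0'.
  have Nq : (N * q).-1.+1 = (N * q)%N by rewrite prednK// muln_gt0 q0 N0'.
  (* With [m.+1 = N * p], the size [m.+2] is the [(N * p).+1] of [bad]; likewise for [n]. *)
  rewrite -Np -Nq; apply: (interface_right_of_not_bad M r lam) => //.
  + by rewrite Np ltnS; exact: leq_trans (ltnW (NM _ p0)) (leq_addr _ _).
  + by rewrite Nq ltnS; exact: leq_trans (ltnW (NM _ q0)) (leq_addl _ _).
  + rewrite Np Nq => Hb; apply: nB; rewrite /BAD.
    have NK' : (N - N1 < K)%N by rewrite ltn_subLR.
    rewrite (bigD1 (Ordinal NK'))//=; left.
    by rewrite /bad /= subnKC.
Qed.

End interface_right.

(** * The competition interface of the theorem *)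

Section interface.
Context {R : realType} {T : Type}.
Implicit Types (w : int * int -> T -> R) (t : T).

Lemma path_weight_le w t p : path up_right_step (1, 1) p ->
  exists i j : nat, last (1, 1) p = (Posz i.+1, Posz j.+1) /\
    \sum_(x <- (1, 1) :: p) w x t <= lpp (quadrant w t) i j.
Proof.
elim/last_ind: p => [_|p x IH]; first by exists 0%N, 0%N; rewrite big_seq1 lpp00.
rewrite rcons_path last_rcons => /andP[/IH[i [j [lp Hs]]]].
rewrite lp /up_right_step /= -rcons_cons big_rcons /=.
have -> : (Posz i.+1 + 1)%R = Posz i.+2 by rewrite -PoszD addn1.
have -> : (Posz j.+1 + 1)%R = Posz j.+2 by rewrite -PoszD addn1.
move=> /orP[/eqP->|/eqP->]; rewrite big_cons in Hs *.
  exists i.+1, j; split => //; apply: le_trans (lpp_right _ _ _).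
  by rewrite /quadrant; lra.
exists i, j.+1; split => //; apply: le_trans (lpp_up _ _ _).
by rewrite /quadrant; lra.
Qed.

Lemma path_weight_attained w t i j : exists p,
  up_right_path (1, 1) (Posz i.+1, Posz j.+1) p /\
  lpp (quadrant w t) i j = \sum_(x <- (1, 1) :: p) w x t.
Proof.
have ext a b a' b' p : up_right_path (1, 1) (Posz a.+1, Posz b.+1) p ->
    up_right_step (Posz a.+1, Posz b.+1) (Posz a'.+1, Posz b'.+1) ->
    up_right_path (1, 1) (Posz a'.+1, Posz b'.+1) (rcons p (Posz a'.+1, Posz b'.+1)).
  by move=> [Hp Hl] Hs; split; [rewrite rcons_path Hp Hl|rewrite last_rcons].
have sE a b : up_right_step (Posz a.+1, Posz b.+1) (Posz a.+2, Posz b.+1).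
  by apply/orP; left; apply/eqP; congr (_, _); rewrite -PoszD addn1.
have sN a b : up_right_step (Posz a.+1, Posz b.+1) (Posz a.+1, Posz b.+2).
  by apply/orP; right; apply/eqP; congr (_, _); rewrite -PoszD addn1.
elim: i j => [|i IHi]; elim => [|j IHj].
- by exists [::]; rewrite big_seq1 lpp00.
- have [p [Hp Hs]] := IHj; exists (rcons p (Posz 1, Posz j.+2)); split.
    exact: ext Hp (sN _ _).
  by rewrite lpp0S Hs -rcons_cons [in RHS]big_rcons /= addrC.
- have [p [Hp Hs]] := IHi 0%N; exists (rcons p (Posz i.+2, Posz 1)); split.
    exact: ext Hp (sE _ _).
  by rewrite lppS0 Hs -rcons_cons [in RHS]big_rcons /= addrC.
- rewrite lppSS; case: leP => _.
    have [p [Hp Hs]] := IHj; exists (rcons p (Posz i.+2, Posz j.+2)); split.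
      exact: ext Hp (sN _ _).
    by rewrite Hs -rcons_cons [in RHS]big_rcons /= addrC.
  have [p [Hp Hs]] := IHi j.+1; exists (rcons p (Posz i.+2, Posz j.+2)); split.
    exact: ext Hp (sE _ _).
  by rewrite Hs -rcons_cons [in RHS]big_rcons /= addrC.
Qed.

Lemma G_lpp w t i j : G w (Posz i.+1, Posz j.+1) t = lpp (quadrant w t) i j.
Proof.
rewrite /G /= /Gpp; set S := mkset _.
have [p [Hp Hs]] := path_weight_attained w t i j.
have ubS : ubound S (lpp (quadrant w t) i j).
  move=> _ [p' [[Hp' Hl] ->]].
  have [i' [j' [Hl' Hle]]] := path_weight_le w t p' Hp'.
  by move: Hl'; rewrite Hl => -[-> ->].
have SL : S (lpp (quadrant w t) i j) by exists p.
apply/eqP; rewrite eq_le; apply/andP; split.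
  by apply: ge_sup => //; exists (lpp (quadrant w t) i j).
by apply: ub_le_sup => //; exists (lpp (quadrant w t) i j).
Qed.

(** [phi] counted from [(0, 0)]; its coordinates are at least 1, so the predecessors lose nothing
    ([phi_interface_coord]). *)
Definition coord w t n : nat * nat := ((absz (phi w t n).1).-1, (absz (phi w t n).2).-1).

Arguments coord : simpl never.

Lemma phi_interface_coord w t n : phi w t n = (Posz (coord w t n).1.+1, Posz (coord w t n).2.+1) /\
  coord w t n.+1 = let: (x, y) := coord w t n in
    if lpp (quadrant w t) x.+1 y < lpp (quadrant w t) x y.+1 then (x.+1, y) else (x, y.+1).
Proof.
have aux m : phi w t m = (Posz (coord w t m).1.+1, Posz (coord w t m).2.+1) ->
    phi w t m.+1 = (Posz (coord w t m.+1).1.+1, Posz (coord w t m.+1).2.+1) /\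
    coord w t m.+1 = let: (x, y) := coord w t m in
    if lpp (quadrant w t) x.+1 y < lpp (quadrant w t) x y.+1 then (x.+1, y) else (x, y.+1).
  case: (coord w t m) => x y /= E; rewrite /coord /= E /=.
  have -> : (Posz x.+1 + 1)%R = Posz x.+2 by rewrite -PoszD addn1.
  have -> : (Posz y.+1 + 1)%R = Posz y.+2 by rewrite -PoszD addn1.
  by rewrite !G_lpp; case: ifPn.
suff H : phi w t n = (Posz (coord w t n).1.+1, Posz (coord w t n).2.+1).
  by split => //; case: (aux n H).
by elim: n => [//|n IH]; case: (aux n IH).
Qed.

Lemma weak_interface_coord w t : weak_interface (quadrant w t) (coord w t).
Proof.
split => // n; have [_] := phi_interface_coord w t n; case: (coord w t n) => x y ->.
by case: ltP => H; [left; rewrite ltW|right].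
Qed.

Lemma lpp_tr (u : nat -> nat -> R) i j : lpp (fun a b => u b a) i j = lpp u j i.
Proof.
elim: i j => [|i IHi]; elim => [|j IHj].
- by [].
- by rewrite lpp0S lppS0 IHj.
- by rewrite lpp0S lppS0 IHi.
- by rewrite !lppSS IHi IHj maxC.
Qed.

Definition transpose w (z : int * int) : T -> R := w (z.2, z.1).

Lemma weak_interface_tr (u : nat -> nat -> R) (f : nat -> nat * nat) :
  weak_interface u f -> weak_interface (fun i j => u j i) (fun n => ((f n).2, (f n).1)).
Proof.
move=> [H0 H]; split; first by rewrite H0.
have E := lpp_tr u.
move=> n; have := H n; case: (f n) => x y /=; rewrite !E.
by case=> -[-> ?]; [right|left].
Qed.

End interface.
Arguments coord : simpl never.

Section transposed_weights.
Context {R : realType} {d : measure_display} {T : measurableType d}.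
Context (P : probability T R) (w : int * int -> T -> R).

Lemma mutually_independent_tr : mutually_independent P w ->
  mutually_independent P (transpose w).
Proof.
pose sw (z : int * int) := (z.2, z.1).
have swK : involutive sw by case.
move=> H s B us mB.
have us' : uniq (map sw s) by rewrite map_inj_uniq//; exact: inv_inj.
have := H (map sw s) (B \o sw) us' (fun i => mB (sw i)).
rewrite big_map => Hs.
transitivity (P (\bigcap_(i in [set` [seq sw i | i <- s]]) w i @^-1` (B \o sw) i)).
  congr (P _); apply/seteqP; split => t Ht.
    by move=> _ /mapP[[x y] xys ->]; exact: (Ht (x, y) xys).
  by move=> [x y] xys; exact: (Ht (sw (x, y)) (map_f sw xys)).
by rewrite Hs; apply: eq_bigr => -[x y] _.
Qed.

End transposed_weights.

(** * From sampled points to the slope of the interface *)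

Section slopes.
Context {R : realType} {d : measure_display} {T : measurableType d}.
Context (P : probability T R).

(** The slope is eventually at most [s], the successors being coordinates counted from 1. Exchanging
    the coordinates and inverting [s] gives the reverse bound. *)
Definition slope_le (f : T -> nat -> nat * nat) (s : R) : set T :=
  \bigcup_n0 \bigcap_(n in [set n | (n0 <= n)%N])
    [set t | (f t n).2.+1%:R <= s * (f t n).1.+1%:R].

Definition discrete_measurable (f : T -> nat -> nat * nat) :=
  forall n (Q : nat * nat -> Prop), measurable [set t | Q (f t n)].

Lemma measurable_slope_le f s : discrete_measurable f -> measurable (slope_le f s).
Proof.
move=> mf; apply: bigcupT_measurable => n0; apply: bigcap_measurable.
  by exists n0 => /=.
by move=> n _; exact: (mf n (fun z => z.2.+1%:R <= s * z.1.+1%:R)).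
Qed.

Lemma weak_interface_fst_mono (u : nat -> nat -> R) (f : nat -> nat * nat) m n :
  weak_interface u f -> (m <= n)%N -> ((f m).1 <= (f n).1)%N.
Proof.
move=> [_ H] /subnK <-; elim: (n - m)%N => // k IH; apply: leq_trans IH _.
by rewrite addSn; have := H (k + m)%N; case: (f (k + m)%N) => x y /= [[-> _]|[-> _]] /=.
Qed.

(** Between sampled times [N * (p + q)] the first coordinate does not decrease, so the second
    exceeds [N * q] by less than [p + q], which the gap [q < s * p] absorbs for large [N]. *)
Lemma eventual_slope (u : nat -> nat -> R) (f : nat -> nat * nat) (p q N1 : nat) (s : R) :
  weak_interface u f -> (0 < p)%N -> (0 < q)%N -> q%:R < s * p%:R ->
  (forall N, (N1 <= N)%N -> (N * p <= (f (N * p + N * q)%N).1)%N) ->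
  exists n0, forall n, (n0 <= n)%N -> (f n).2.+1%:R <= s * (f n).1.+1%:R.
Proof.
move=> Hf p0 q0 qsp H.
have pq0 : (0 < p + q)%N by rewrite addn_gt0 p0.
have s0 : 0 < s.
  have p0' : 0 < p%:R :> R by rewrite ltr0n.
  by rewrite -(pmulr_lgt0 _ p0'); apply: le_lt_trans qsp.
pose N2 := (Num.truncn ((p + q)%:R / (s * p%:R - q%:R))).+1.
exists (maxn N1 N2 * (p + q))%N => n nn.
pose N := (n %/ (p + q))%N.
have NN : (maxn N1 N2 <= N)%N by rewrite leq_divRL.
have N1N : (N1 <= N)%N by exact: leq_trans (leq_maxl _ _) NN.
have N2N : (N2 <= N)%N by exact: leq_trans (leq_maxr _ _) NN.
have xN : (N * p <= (f n).1)%N.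
  apply: leq_trans (H N N1N) _; apply: weak_interface_fst_mono Hf _.
  by rewrite -mulnDr leq_trunc_div.
have lev := weak_interface_level _ _ n Hf.
have nlt : (n < N.+1 * (p + q))%N by rewrite ltn_ceil.
have yN : ((f n).2.+1 <= N * q + (p + q))%N.
  move: nlt lev xN; rewrite mulSn mulnDr; lia.
have yN' : (f n).2.+1%:R <= N%:R * q%:R + (p + q)%:R :> R.
  by rewrite -natrM -natrD ler_nat.
have xN' : N%:R * p%:R <= (f n).1.+1%:R :> R.
  by rewrite -natrM ler_nat leqW.
apply: le_trans yN' _; apply: (@le_trans _ _ (s * (N%:R * p%:R))); last by rewrite ler_pM2l.
have spq : 0 < s * p%:R - q%:R by rewrite subr_gt0.
have : (p + q)%:R <= N%:R * (s * p%:R - q%:R).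
  rewrite -ler_pdivrMr//; apply/ltW; apply: lt_le_trans (truncnS_gt _) _.
  by rewrite ler_nat.
by move=> H3; rewrite -lerBrDl; apply: le_trans H3 _; rewrite le_eqVlt; apply/orP; left; apply/eqP; ring.
Qed.

Lemma slope_le_prob (w : int * int -> T -> R) (f : T -> nat -> nat * nat) (s r : R) :
  (forall z, measurable_fun setT (w z)) ->
  (forall z (A : set R), measurable A ->
    P (w z @^-1` A) = exponential_prob (1 : R) A) ->
  mutually_independent P w ->
  (forall t, weak_interface (quadrant w t) (f t)) -> discrete_measurable f ->
  0 < r < 1 -> (1 - r) ^+ 2 < s * r ^+ 2 ->
  ((1 - r)%R%:E <= P (slope_le f s))%E.
Proof.
move=> w_meas w_exp w_indep Hf mf r01 rs; case/andP: (r01) => r0 r1.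
have [p [q [p0 q0 qup pqr]]] : exists p q : nat, [/\ (0 < p)%N, (0 < q)%N,
    q%:R < s * p%:R & p%:R * (1 - r) ^+ 2 < q%:R * r ^+ 2].
  pose c := (1 - r) ^+ 2 / r ^+ 2.
  have r20 : 0 < r ^+ 2 by rewrite exprn_gt0.
  have cs : c < s by rewrite ltr_pdivrMr.
  have c0 : 0 <= c by apply: divr_ge0; apply: exprn_ge0; lra.
  have sc : 0 < s - c by rewrite subr_gt0.
  (* Once [p * (s - c) > 1], an integer [q] fits strictly between [p * c] and [p * s]. *)
  pose p := (Num.truncn (s - c)^-1).+1.
  have psc : 1 < p%:R * (s - c).
    by rewrite -ltr_pdivrMr// div1r; exact: truncnS_gt.
  pose q := (Num.truncn (p%:R * c)).+1.
  have pc0 : 0 <= p%:R * c by rewrite mulr_ge0.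
  have qlow : p%:R * c < q%:R by exact: truncnS_gt.
  have qup : q%:R < s * p%:R.
    have : q%:R <= p%:R * c + 1 by rewrite -natr1 lerD2r truncn_le.
    by move: psc; rewrite mulrBr; lra.
  by exists p, q; split => //; rewrite -ltr_pdivrMr// -mulrA.
apply/lee_addgt0Pr => e e0.
have [N1 HN1] := interface_right_prob P w w_meas w_exp w_indep f p q r e
  Hf p0 q0 r01 pqr e0.
(* These events mention no box and decrease with [K], whereas the sets [F] bounding their
   probabilities change with the box. *)
pose A K := \bigcap_(N in [set N | (N1 <= N < N1 + K)%N])
   [set t | (N * p <= (f t (N * p + N * q)%N).1)%N].
have mA K : measurable (A K).
  case: K => [|K].
    rewrite /A (_ : [set N | _] = set0) ?bigcap_set0//.
    by apply/seteqP; split => N //=; lia.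
  apply: bigcap_measurable; first by exists N1; rewrite /=; lia.
  by move=> N _; exact: (mf _ (fun z => (N * p <= z.1)%N)).
have PA K : ((1 - r - e)%R%:E <= P (A K))%E.
  have [F [mF PF HF]] := HN1 K; apply: (le_trans PF).
  by apply: le_measure; rewrite ?inE// => t Ft N /= HN; exact: HF.
have mAA : measurable (\bigcap_K A K) by exact: bigcapT_measurable.
have PAA : ((1 - r - e)%R%:E <= P (\bigcap_K A K))%E.
  have cA : (P \o A) x @[x --> \oo] --> P (\bigcap_K A K).
    apply: nonincreasing_cvg_mu => //.
      by rewrite (le_lt_trans (probability_le1 _ _))// ltry.
    by move=> m n mn; apply/subsetPset => t At N /= HN; apply: At; rewrite /=; lia.
  rewrite -(cvg_lim _ cA)//; apply: lime_ge; first by apply/cvg_ex; exists (P (\bigcap_K A K)).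
  by apply: nearW => K; exact: PA.
rewrite EFinB leeBlDr// in PAA.
apply: (le_trans PAA); rewrite leeD2r//.
apply: le_measure; rewrite ?inE//; first exact: measurable_slope_le.
move=> t At.
have [|n0 Hn0] := eventual_slope (quadrant w t) (f t) p q N1 s (Hf t) p0 q0 qup.
  by move=> N N1N; apply: (At (N - N1).+1 Logic.I N) => /=; lia.
by exists n0 => // n /= n0n; exact: Hn0.
Qed.

End slopes.

Section psi_measurable.
Context {R : realType} {d : measure_display} {T : measurableType d}.
Context (w : int * int -> T -> R) (w_meas : forall z, measurable_fun setT (w z)).

Lemma measurable_lpp i j : measurable_fun setT (fun t => lpp (quadrant w t) i j).
Proof.
have mq a b : measurable_fun setT (fun t => quadrant w t a b) by exact: w_meas.
elim: i j => [|i IHi]; elim => [|j IHj].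
- exact: mq.
- exact: (measurable_funD (mq _ _) IHj).
- exact: (measurable_funD (mq _ _) (IHi 0%N)).
- exact: (measurable_funD (mq _ _) (measurable_maxr (IHi _) IHj)).
Qed.

Lemma measurable_interface_coord n z : measurable [set t | coord w t n = z].
Proof.
elim: n z => [|n IH] z.
  have [->|z0] := eqVneq z (0, 0)%N.
    by rewrite (_ : mkset _ = setT)//; apply/seteqP; split.
  rewrite (_ : mkset _ = set0)//; apply/seteqP; split => // t /= H.
  by move/eqP: z0; rewrite -H.
have mlt i j i' j' : measurable [set t | lpp (quadrant w t) i j < lpp (quadrant w t) i' j'].
  rewrite (_ : mkset _ = (fun t => lpp (quadrant w t) i' j' - lpp (quadrant w t) i j)
    @^-1` `]0, +oo[%classic).
    by apply: measurable_preim => //; apply: measurable_funB; exact: measurable_lpp.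
  by apply/seteqP; split => t /=; rewrite in_itv /= andbT subr_gt0.
rewrite (_ : mkset _ =
  \bigcup_x \bigcup_y ([set t | coord w t n = (x, y)] `&`
    (([set t | lpp (quadrant w t) x.+1 y < lpp (quadrant w t) x y.+1] `&` [set t | (x.+1, y) = z])
    `|` (~` [set t | lpp (quadrant w t) x.+1 y < lpp (quadrant w t) x y.+1] `&` [set t | (x, y.+1) = z])))).
  apply: bigcupT_measurable => x; apply: bigcupT_measurable => y.
  have mc (Q : Prop) : measurable [set t : T | Q].
    have [HQ|HQ] := pselect Q.
      by rewrite (_ : mkset _ = setT)//; apply/seteqP; split.
    by rewrite (_ : mkset _ = set0)//; apply/seteqP; split.
  apply: measurableI => //; apply: measurableU; apply: measurableI => //.
  exact: measurableC.
apply/seteqP; split => t.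
  rewrite /mkset; have [_ ->] := phi_interface_coord w t n.
  case E : (coord w t n) => [x y] H; exists x => //; exists y => //; split => //.
  by move: H; case: ifPn => H1 H2; [left|right; split => //; exact/negP].
move=> [x _ [y _ [E H]]]; rewrite /mkset; have [_ ->] := phi_interface_coord w t n; rewrite E.
by case: H => -[H1 H2]; [rewrite H1|rewrite ifN//; exact/negP].
Qed.

Lemma discrete_measurable_interface : discrete_measurable (coord w).
Proof.
move=> n Q.
rewrite (_ : mkset _ = \bigcup_x \bigcup_y ([set t | coord w t n = (x, y)] `&` [set t | Q (x, y)])).
  apply: bigcupT_measurable => x; apply: bigcupT_measurable => y.
  have [HQ|HQ] := pselect (Q (x, y)).
    by rewrite (_ : [set t | Q (x, y)] = setT) ?setIT//; [exact: measurable_interface_coord|apply/seteqP; split].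
  by rewrite (_ : [set t | Q (x, y)] = set0) ?setI0//; apply/seteqP; split.
apply/seteqP; split => t /=.
  by case E : (coord w t n) => [x y] H; exists x => //; exists y.
by move=> [x _ [y _ [-> H]]].
Qed.

End psi_measurable.

(** * The asymptotic angle *)

Section limn_sup_bounded.
Context {R : realType} (u : nat -> R) (m M : R).
Hypothesis uB : forall n, m <= u n <= M.

Let ub : has_ubound (range u).
Proof. by exists M => _ [n _ <-]; case/andP: (uB n). Qed.

Let lb : has_lbound (range u).
Proof. by exists m => _ [n _ <-]; case/andP: (uB n). Qed.

Let cvg_sups_limn_sup : sups u @ \oo --> limn_sup u.
Proof.
by have H := cvg_sups_inf ub lb; rewrite /limn_sup (cvg_lim _ H).
Qed.

Let le_sups k n : (k <= n)%N -> u n <= sups u k.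
Proof. by move=> kn; apply: ub_le_sup; [exact/has_ubound_sdrop|exists n]. Qed.

Lemma limn_sup_le a n0 : (forall n, (n0 <= n)%N -> u n <= a) -> limn_sup u <= a.
Proof.
move=> H; rewrite -(cvg_lim _ cvg_sups_limn_sup)//; apply: limr_le.
  by apply/cvg_ex; exists (limn_sup u).
exists n0 => // n /= n0n; apply: ge_sup; first by exists (u n), n => /=.
by move=> _ [k /= nk <-]; apply: H; exact: leq_trans nk.
Qed.

Lemma limn_sup_ge a n0 : (forall n, (n0 <= n)%N -> a <= u n) -> a <= limn_sup u.
Proof.
move=> H; rewrite -(cvg_lim _ cvg_sups_limn_sup)//; apply: limr_ge.
  by apply/cvg_ex; exists (limn_sup u).
exists n0 => // n /= n0n; apply: le_trans (H n n0n) _; exact: le_sups.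
Qed.

Lemma limn_sup_lt a : limn_sup u < a -> exists n0, forall n, (n0 <= n)%N -> u n < a.
Proof.
move=> ua.
have /cvgrPdist_lt/(_ (a - limn_sup u)) := cvg_sups_limn_sup.
rewrite subr_gt0 => /(_ ua)[n0 _ H]; exists n0 => n n0n.
have := H n0 (leqnn _); rewrite /= ltr_norml => /andP[H1 _].
by have := le_sups n0 n n0n; lra.
Qed.

End limn_sup_bounded.

Section angles.
Context {R : realType}.

Lemma atan_slope_bounds (x y : nat) : 0 <= atan (y.+1%:R / x.+1%:R : R) <= pi / 2.
Proof.
by rewrite (ltW (atan_ltpi2 _)) andbT -atan0; apply: le_atan; rewrite divr_ge0.
Qed.

Lemma cos_atan_slope (x y : nat) : cos (atan (y.+1%:R / x.+1%:R : R)) =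
  (Posz x.+1)%:~R / enorm (Posz x.+1, Posz y.+1).
Proof.
rewrite cos_atan /enorm /= -!pmulrn.
set X := x.+1%:R; set Y := y.+1%:R.
have X0 : 0 < X :> R by rewrite ltr0n.
have -> : 1 + (Y / X) ^+ 2 = (X ^+ 2 + Y ^+ 2) / X ^+ 2.
  by field; rewrite gt_eqF.
rewrite sqrtrM ?addr_ge0 ?exprn_ge0 ?ler0n// sqrtrV ?exprn_ge0 ?ler0n//.
by rewrite sqrtr_sqr gtr0_norm// invfM invrK mulrC.
Qed.

Lemma sin_atan_slope (x y : nat) : sin (atan (y.+1%:R / x.+1%:R : R)) =
  (Posz y.+1)%:~R / enorm (Posz x.+1, Posz y.+1).
Proof.
set z := y.+1%:R / x.+1%:R.
have c0 : cos (atan z) != 0.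
  by rewrite gt_eqF// cos_gt0_pihalf// atan_gtNpi2 atan_ltpi2.
have := atanK z; rewrite /tan => /(congr1 (fun a => a * cos (atan z))).
by rewrite divfK// => ->; rewrite cos_atan_slope /z -!pmulrn mulrA divfK.
Qed.

Lemma law_tan (al : R) : 0 <= al < pi / 2 ->
  Num.sqrt (tan al) / (1 + Num.sqrt (tan al)) =
  Num.sqrt (sin al) / (Num.sqrt (sin al) + Num.sqrt (cos al)).
Proof.
move=> /andP[a0 a1].
have c0 : 0 < cos al.
  by rewrite cos_gt0_pihalf// a1 andbT (lt_le_trans _ a0)// oppr_lt0 divr_gt0// pi_gt0.
have s0 : 0 <= sin al.
  by rewrite sin_ge0_pi// a0/= (le_trans (ltW a1))// ler_pdivrMr// ler_peMr ?pi_ge0// ler1n.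
have sc0 : 0 < Num.sqrt (cos al) by rewrite sqrtr_gt0.
rewrite /tan sqrtrM// sqrtrV ?ltW//.
have ss0 : 0 <= Num.sqrt (sin al) by exact: sqrtr_ge0.
field; rewrite !gt_eqF//=; apply: ltr_wpDl => //.
Qed.

Lemma dense_fraction (a b : R) : 0 <= a -> a < b ->
  exists i j : nat, a < i.+1%:R / j.+1%:R < b.
Proof.
move=> a0 ab; have ba : 0 < b - a by rewrite subr_gt0.
pose j := Num.truncn (b - a)^-1.
have jba : 1 < j.+1%:R * (b - a) by rewrite -ltr_pdivrMr// div1r; exact: truncnS_gt.
exists (Num.truncn (j.+1%:R * a)), j.
rewrite ltr_pdivlMr// ltr_pdivrMr// mulrC truncnS_gt/=.
have : (Num.truncn (j.+1%:R * a))%:R <= j.+1%:R * a by rewrite truncn_le mulr_ge0.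
by rewrite -natr1; move: jba; rewrite mulrBr; lra.
Qed.

End angles.

Lemma ltr_sqr_nneg {R : realFieldType} (x y : R) : 0 <= x -> x < y -> x ^+ 2 < y ^+ 2.
Proof. by move=> x0 xy; rewrite !expr2; nra. Qed.

Section limit_angle.
Context {R : realType} {d : measure_display} {T : measurableType d}.
Context (P : probability T R) (w : int * int -> T -> R).
Context (w_meas : forall z, measurable_fun setT (w z)).
Context (w_exp : forall z (A : set R), measurable A ->
  P (w z @^-1` A) = exponential_prob (1 : R) A).
Context (w_indep : mutually_independent P w).

Definition slope_below (s : R) := slope_le (coord w) s.
Definition slope_above (s : R) := slope_le (fun t n => ((coord w t n).2, (coord w t n).1)) s^-1.
Definition interface_angle t n : R := atan ((coord w t n).2.+1%:R / (coord w t n).1.+1%:R).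
(** An upper limit is defined and measurable everywhere, even where the angles do not converge. *)
Definition asymptotic_angle t : R := limn_sup (interface_angle t).

Let mcoord := discrete_measurable_interface w w_meas.

Lemma measurable_slope_below s : measurable (slope_below s).
Proof. exact: measurable_slope_le. Qed.

Lemma measurable_slope_above s : measurable (slope_above s).
Proof.
by apply: measurable_slope_le => n Q; exact: (mcoord n (fun z => Q (z.2, z.1))).
Qed.

Lemma slope_below_prob s r : 0 < r < 1 -> (1 - r) ^+ 2 < s * r ^+ 2 ->
  ((1 - r)%R%:E <= P (slope_below s))%E.
Proof.
move=> r01 rs; apply: (slope_le_prob P w) => //.
by move=> t; exact: weak_interface_coord.
Qed.

Lemma slope_above_prob s r : 0 < s -> 0 < r < 1 -> s * (1 - r) ^+ 2 < r ^+ 2 ->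
  ((1 - r)%R%:E <= P (slope_above s))%E.
Proof.
move=> s0 r01 rs; apply: (slope_le_prob P (transpose w)).
- by move=> z; exact: w_meas.
- by move=> z A mA; exact: w_exp.
- exact: mutually_independent_tr.
- by move=> t; exact: (weak_interface_tr (quadrant w t) _ (weak_interface_coord w t)).
- by move=> n Q; exact: (mcoord n (fun z => Q (z.2, z.1))).
- by [].
- by rewrite mulrC ltr_pdivlMr// mulrC.
Qed.

Lemma interface_angle_bounds t n : 0 <= interface_angle t n <= pi / 2.
Proof. exact: atan_slope_bounds. Qed.

Lemma slope_below_angle s t : slope_below s t ->
  exists n0, forall n, (n0 <= n)%N -> interface_angle t n <= atan s.
Proof.
move=> [n0 _ H]; exists n0 => n n0n; apply: le_atan.
by rewrite ler_pdivrMr//; exact: (H n).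
Qed.

Lemma slope_above_angle s t : 0 < s -> slope_above s t ->
  exists n0, forall n, (n0 <= n)%N -> atan s <= interface_angle t n.
Proof.
move=> s0 [n0 _ H]; exists n0 => n n0n; apply: le_atan.
have := H n n0n; rewrite /= => Hn.
by rewrite ler_pdivlMr// -ler_pdivlMl.
Qed.

Lemma asymptotic_angle_bounds t : 0 <= asymptotic_angle t <= pi / 2.
Proof.
apply/andP; split.
  by apply: (limn_sup_ge _ _ _ (interface_angle_bounds t) _ 0) => n _; case/andP: (interface_angle_bounds t n).
by apply: (limn_sup_le _ _ _ (interface_angle_bounds t) _ 0) => n _; case/andP: (interface_angle_bounds t n).
Qed.

Lemma measurable_asymptotic_angle : measurable_fun setT asymptotic_angle.
Proof.
apply: (measurable_fun_limn_sup (h := fun n t => interface_angle t n)).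
- by move=> t _; exists (pi / 2) => _ [n _ <-]; case/andP: (interface_angle_bounds t n).
- by move=> t _; exists 0 => _ [n _ <-]; case/andP: (interface_angle_bounds t n).
- move=> n _ Y mY; rewrite setTI.
  exact: (mcoord n (fun z => Y (atan (z.2.+1%:R / z.1.+1%:R)))).
Qed.

Lemma measurable_asymptotic_angle_le a : measurable [set t | asymptotic_angle t <= a].
Proof.
rewrite (_ : mkset _ = asymptotic_angle @^-1` `]-oo, a]%classic).
  by apply: measurable_preim => //; exact: measurable_asymptotic_angle.
by apply/seteqP; split => t /=; rewrite in_itv.
Qed.

(** For [s'] strictly between [s] and [r ^+ 2 / (1 - r) ^+ 2], the upper limit exceeds [atan s] on
    [slope_above s'], so the event lies in a complement of probability at most [r]. *)
Lemma asymptotic_angle_upper s r : 0 <= s -> 0 < r < 1 -> s * (1 - r) ^+ 2 < r ^+ 2 ->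
  (P [set t | (asymptotic_angle t <= atan s)%R] <= r%:E)%E.
Proof.
move=> s0 r01 rs; case/andP: (r01) => r0 r1.
have r20 : 0 < (1 - r) ^+ 2 by rewrite exprn_gt0// subr_gt0.
pose s' := (s + r ^+ 2 / (1 - r) ^+ 2) / 2.
have sr : s < r ^+ 2 / (1 - r) ^+ 2 by rewrite ltr_pdivlMr.
have ss' : s < s' by rewrite /s'; lra.
have rs' : s' * (1 - r) ^+ 2 < r ^+ 2 by rewrite -ltr_pdivlMr// /s'; lra.
have s'0 : 0 < s' by exact: le_lt_trans ss'.
have mH := measurable_slope_above s'.
apply: (@le_trans _ _ (P (~` slope_above s'))).
  apply: le_measure; rewrite ?inE; [exact: measurable_asymptotic_angle_le|exact: measurableC|].
  move=> t /= Ht /(slope_above_angle _ _ s'0)[n0 Hn].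
  have := limn_sup_ge _ _ _ (interface_angle_bounds t) _ _ Hn.
  rewrite -/(asymptotic_angle t) => /le_trans/(_ Ht); rewrite leNgt.
  by rewrite lt_atan.
rewrite probability_setC// leeBlDr ?fin_num_measure//.
have := leeD (lexx r%:E) (slope_above_prob _ _ s'0 r01 rs').
by rewrite -EFinD addrC subrK addeC.
Qed.

Lemma asymptotic_angle_lower s r : 0 < r < 1 -> (1 - r) ^+ 2 < s * r ^+ 2 ->
  ((1 - r)%R%:E <= P [set t | (asymptotic_angle t <= atan s)%R])%E.
Proof.
move=> r01 rs; apply: (le_trans (slope_below_prob _ _ r01 rs)).
apply: le_measure; rewrite ?inE; [exact: measurable_slope_below|exact: measurable_asymptotic_angle_le|].
move=> t /slope_below_angle[n0 Hn]; exact: limn_sup_le (interface_angle_bounds t) _ _ Hn.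
Qed.

(** With [c = sqrt s], the conditions on [r] in the upper and lower bounds become equalities at
    [c / (1 + c)] and [1 / (1 + c)], where both bounds equal [c / (1 + c)]; they are approached up
    to [e]. *)
Lemma asymptotic_angle_law s : 0 <= s ->
  P [set t | asymptotic_angle t <= atan s] = (Num.sqrt s / (1 + Num.sqrt s))%:E.
Proof.
move=> s0; have mA := measurable_asymptotic_angle_le (atan s).
have fA := fin_num_measure P _ mA.
have upper r : 0 < r < 1 -> s * (1 - r) ^+ 2 < r ^+ 2 ->
    fine (P [set t | asymptotic_angle t <= atan s]) <= r.
  by move=> r01 rs; rewrite -lee_fin fineK//; exact: asymptotic_angle_upper.
have lower r : 0 < r < 1 -> (1 - r) ^+ 2 < s * r ^+ 2 ->
    1 - r <= fine (P [set t | asymptotic_angle t <= atan s]).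
  by move=> r01 rs; rewrite -lee_fin fineK//; exact: asymptotic_angle_lower.
have ge0 : 0 <= fine (P [set t | asymptotic_angle t <= atan s]) by exact: fine_ge0.
have le1 : fine (P [set t | asymptotic_angle t <= atan s]) <= 1.
  by rewrite -lee_fin fineK// probability_le1.
rewrite -(fineK fA); congr EFin; move: upper lower ge0 le1.
move: (fine _) => p upper lower ge0 le1.
have := sqr_sqrtr s0; have := sqrtr_ge0 s; set c := Num.sqrt s => c0 c2.
have c1 : 0 < 1 + c by lra.
have cc : c / (1 + c) * (1 + c) = c by rewrite divfK// gt_eqF.
have cc0 : 0 <= c / (1 + c) by rewrite divr_ge0// ltW.
apply/eqP; rewrite eq_le; apply/andP; split; apply/ler_addgt0Pr => e e0.
- case: (leP 1 (c / (1 + c) + e)) => [|r1]; first exact: le_trans.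
  apply: upper; first by rewrite r1 andbT ltr_wpDl.
  by rewrite -c2 -exprMn; apply: ltr_sqr_nneg; nra.
- rewrite -lerBlDr.
  case: (leP 1 (1 - c / (1 + c) + e)) => [?|r1]; first by apply: le_trans ge0; lra.
  have r0 : 0 < 1 - c / (1 + c) + e by nra.
  have -> : c / (1 + c) - e = 1 - (1 - c / (1 + c) + e) by lra.
  apply: lower; first by rewrite r0.
  by rewrite -c2 -exprMn; apply: ltr_sqr_nneg; nra.
Qed.

(** For [s' < s], [slope_below s'] and [slope_above s] are disjoint, and lower bounds of their
    probabilities add up to nearly 1. Hence the slope almost surely does not oscillate across
    [s]. *)
Lemma slope_below_or_above s : 0 < s -> P (~` (slope_below s `|` slope_above s)) = 0%E.
Proof.
move=> s0.
have mL := measurable_slope_below; have mH := measurable_slope_above.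
have mU : measurable (slope_below s `|` slope_above s) by exact: measurableU.
have fU := fin_num_measure P _ mU.
suff : (1 <= P (slope_below s `|` slope_above s))%E.
  move=> H; rewrite probability_setC// (_ : P _ = 1%E) ?subee//.
  by apply/eqP; rewrite eq_le H probability_le1.
have key r r' : 0 < r < 1 -> 0 < r' < 1 -> (1 - r) ^+ 2 < s * r ^+ 2 ->
    s * (1 - r') ^+ 2 < r' ^+ 2 ->
    (1 - r) + (1 - r') <= fine (P (slope_below s `|` slope_above s)).
  move=> r01 r'01 rs r's; case/andP: (r01) => r0 r1.
  have r20 : 0 < r ^+ 2 by rewrite exprn_gt0.
  pose s' := (s + (1 - r) ^+ 2 / r ^+ 2) / 2.
  have sr : (1 - r) ^+ 2 / r ^+ 2 < s by rewrite ltr_pdivrMr.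
  have ss' : s' < s by rewrite /s'; lra.
  have rs' : (1 - r) ^+ 2 < s' * r ^+ 2 by rewrite -ltr_pdivrMr// /s'; lra.
  rewrite -lee_fin fineK// EFinD.
  apply: (le_trans (leeD (slope_below_prob _ _ r01 rs') (slope_above_prob _ _ s0 r'01 r's))).
  rewrite -measureU//.
    apply: le_measure; rewrite ?inE//; first exact: measurableU.
    apply: setSU => t [n0 _ H]; exists n0 => // n n0n; apply: le_trans (H n n0n) _.
    by rewrite ler_wpM2r// ltW.
  apply/seteqP; split => // t [[n0 _ H] [n1 _ H1]].
  have := H (maxn n0 n1) (leq_maxl _ _); have := H1 (maxn n0 n1) (leq_maxr _ _) => /=.
  case: (coord w t (maxn n0 n1)) => x y /=; rewrite ler_pdivlMl// => H2 H3.
  have := le_trans H2 H3; rewrite ler_pM2r// leNgt ss' //.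
rewrite -(fineK fU) lee_fin; move: key; move: (fine _) => p key.
have := sqr_sqrtr (ltW s0); have := s0; rewrite -sqrtr_gt0; set c := Num.sqrt s => c0 c2.
have c1 : 0 < 1 + c by lra.
have cc : c / (1 + c) * (1 + c) = c by rewrite divfK// gt_eqF.
set a := c / (1 + c) in cc.
have a0 : 0 < a by rewrite divr_gt0.
have a1 : a < 1 by nra.
apply/ler_addgt0Pr => e e0.
(* The total loss is [2 * e']; the other two bounds keep both parameters below 1. *)
pose e' := Num.min (e / 2) (Num.min (a / 2) ((1 - a) / 2)).
have e'0 : 0 < e' by rewrite !lt_min; lra.
have [e'1 e'2 e'3] : [/\ e' <= e / 2, e' <= a / 2 & e' <= (1 - a) / 2].
  by rewrite /e' !ge_min !lexx !orbT.
have := key (1 - a + e') (a + e').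
rewrite -c2 -!exprMn => H.
suff : 1 - (1 - a + e') + (1 - (a + e')) <= p by lra.
apply: H; [lra|lra| |].
- by apply: ltr_sqr_nneg; nra.
- by apply: ltr_sqr_nneg; nra.
Qed.

(** Take a fraction whose arctangent lies between the upper limit minus [e] and minus [e / 2].
    [slope_below] at this fraction would contradict the upper limit, so [slope_above] holds and
    bounds the angles from below. Fractions leave only countably many null events. *)
Lemma interface_angle_cvg :
  {ae P, forall t, interface_angle t n @[n --> \oo] --> asymptotic_angle t}.
Proof.
have H : {ae P, forall t, forall i j : nat,
    (slope_below (i.+1%:R / j.+1%:R) `|` slope_above (i.+1%:R / j.+1%:R)) t}.
  apply/ae_foralln => i; apply/ae_foralln => j.
  have m : measurable (~` (slope_below (i.+1%:R / j.+1%:R) `|` slope_above (i.+1%:R / j.+1%:R))).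
    by apply: measurableC; apply: measurableU; [exact: measurable_slope_below|exact: measurable_slope_above].
  exists (~` (slope_below (i.+1%:R / j.+1%:R) `|` slope_above (i.+1%:R / j.+1%:R))); split => //.
  by apply: slope_below_or_above; rewrite divr_gt0.
apply: filterS H => t Ht.
have /andP[th0 th1] := asymptotic_angle_bounds t.
apply/cvgrPdist_lt => e e0.
have [n0 Hn0] : exists n0, forall n, (n0 <= n)%N -> interface_angle t n < asymptotic_angle t + e.
  by apply: (limn_sup_lt _ _ _ (interface_angle_bounds t)); rewrite ltrDl.
have [n1 Hn1] : exists n1, forall n, (n1 <= n)%N -> asymptotic_angle t - e < interface_angle t n.
  case: (ltP (asymptotic_angle t - e) 0) => te.
    by exists 0%N => n _; apply: lt_le_trans te _; case/andP: (interface_angle_bounds t n).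
  have pi0 := pi_gt0 R.
  pose b := asymptotic_angle t - e / 2.
  have Ia : asymptotic_angle t - e \in `](- (pi / 2)), (pi / 2)[ by rewrite in_itv /=; lra.
  have Ib : b \in `](- (pi / 2)), (pi / 2)[ by rewrite in_itv /= /b; lra.
  have tab : tan (asymptotic_angle t - e) < tan b by rewrite ltr_tan// /b; lra.
  have ta0 : 0 <= tan (asymptotic_angle t - e).
    case: (eqVneq (asymptotic_angle t - e) 0) => [->|te0]; first by rewrite tan0.
    rewrite -tan0 ltW// ltr_tan//; first by rewrite lt_neqAle eq_sym te0.
    by rewrite in_itv /=; lra.
  have [i [j /andP[Ha Hb]]] := dense_fraction _ _ ta0 tab.
  set s := i.+1%:R / j.+1%:R in Ha Hb.
  have s0 : 0 < s by rewrite divr_gt0.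
  have as1 : asymptotic_angle t - e < atan s by rewrite -(tanK Ia); exact: lt_atan.
  have as2 : atan s < b by rewrite -(tanK Ib); exact: lt_atan.
  case: (Ht i j) => [/slope_below_angle[n1 Hn1]|/(slope_above_angle _ _ s0)[n1 Hn1]].
    have := limn_sup_le _ _ _ (interface_angle_bounds t) _ _ Hn1.
    by rewrite -/(asymptotic_angle t) -/s => H3; exfalso; move: as2; rewrite /b; lra.
  by exists n1 => n nn; apply: lt_le_trans as1 _; exact: Hn1.
exists (maxn n0 n1) => // n /= nn.
have := Hn0 n (leq_trans (leq_maxl _ _) nn); have := Hn1 n (leq_trans (leq_maxr _ _) nn).
by rewrite ltr_norml; lra.
Qed.

End limit_angle.

Theorem theorem1 (d : measure_display) (T : measurableType d) (R : realType)
  (P : probability T R) (w : int * int -> T -> R)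
  (w_meas : forall z, measurable_fun setT (w z))
  (w_exp : forall z (A : set R), measurable A ->
     P (w z @^-1` A) = exponential_prob (1 : R) A)
  (w_indep : mutually_independent P w) :
  exists theta : T -> R,
    [/\ measurable_fun setT theta,
        (forall om, 0 <= theta om <= pi / 2),
        (forall alpha : R, 0 <= alpha <= pi / 2 ->
           P [set om | theta om <= alpha] =
           (Num.sqrt (sin alpha) /
              (Num.sqrt (sin alpha) + Num.sqrt (cos alpha)))%:E) &
        {ae P, forall om,
           ((fun n => ((phi w om n).1)%:~R / enorm (phi w om n)) @ \oo
              --> cos (theta om)) /\
           ((fun n => ((phi w om n).2)%:~R / enorm (phi w om n)) @ \oo
              --> sin (theta om))}].
Proof.
exists (asymptotic_angle w); split.
- exact: measurable_asymptotic_angle.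
- exact: asymptotic_angle_bounds.
(* At [pi / 2] the law cannot be read through the tangent, but the event is certain. *)
- move=> al /andP[a0]; rewrite le_eqVlt => /predU1P[->|a1].
    rewrite sin_pihalf cos_pihalf sqrtr0 addr0 sqrtr1 divr1.
    rewrite (_ : mkset _ = setT) ?probability_setT//.
    by apply/seteqP; split => t //= _; case/andP: (asymptotic_angle_bounds w t).
  have pi0 := pi_gt0 R.
  have Ia : al \in `](- (pi / 2)), (pi / 2)[ by rewrite in_itv /=; lra.
  have t0 : 0 <= tan al.
    case: (eqVneq al 0) => [->|al0]; first by rewrite tan0.
    rewrite -tan0 ltW// ltr_tan//; first by rewrite lt_neqAle eq_sym al0.
    by rewrite in_itv /=; lra.
  by have := asymptotic_angle_law P w w_meas w_exp w_indep _ t0; rewrite (tanK Ia) law_tan// a0.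
- apply: filterS (interface_angle_cvg P w w_meas w_exp w_indep) => t Ht.
  have cosE n : cos (interface_angle w t n) = ((phi w t n).1)%:~R / enorm (phi w t n).
    by have [-> _] := phi_interface_coord w t n; exact: cos_atan_slope.
  have sinE n : sin (interface_angle w t n) = ((phi w t n).2)%:~R / enorm (phi w t n).
    by have [-> _] := phi_interface_coord w t n; exact: sin_atan_slope.
  split.
    under eq_fun do rewrite -cosE.
    by apply: (cvg_comp _ _ Ht); exact: continuous_cos.
  under eq_fun do rewrite -sinE.
  by apply: (cvg_comp _ _ Ht); exact: continuous_sin.
Qed.
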